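(* Let $(A,\cdot,[\,,])$ be a 3-dimensional transposed Poisson algebra over $\mathbb C$. Then the Gelfand--Dorfman algebra $(A,\circ,[\,,])$ with $x\circ y=x\cdot y$ for all $x,y\in A$ is special.
   Context: All algebras are over $\mathbb C$. A transposed Poisson algebra is a triple $(A,\cdot,[\,,])$ where $(A,\cdot)$ is a commutative associative algebra (not necessarily unital), $(A,[\,,])$ is a Lie algebra, and $2z\cdot[x,y]=[z\cdot x,y]+[x,z\cdot y]$ for all $x,y,z\in A$. A Novikov algebra is a vector space with a bilinear product $\circ$ such that $(x\circ y)\circ z-x\circ(y\circ z)=(y\circ x)\circ z-y\circ(x\circ z)$ and $(x\circ y)\circ z=(x\circ z)\circ y$. A Gelfand--Dorfman (GD) algebra is a triple $(A,\circ,[\,,])$ where $(A,\circ)$ is a Novikov algebra, $(A,[\,,])$ is a Lie algebra, and $[x,y\circ z]-[z,y\circ x]+[y,x]\circ z-[y,z]\circ x-y\circ[x,z]=0$ for all $x,y,z$. It is known that for a transposed Poisson algebra, putting $x\circ y=x\cdot y$ gives a GD algebra. A differential Poisson algebra is $(P,\cdot,\{\,,\},d)$ where $(P,\cdot)$ is commutative associative, $\{\,,\}$ is a Lie bracket on $P$ satisfying the Leibniz rule $\{u,v\cdot w\}=\{u,v\}\cdot w+v\cdot\{u,w\}$, and $d:P\to P$ is a linear map that is a derivation of both $\cdot$ and $\{\,,\}$. It induces a GD algebra $P^{(d)}$ on the space $P$ with $[u,v]=\{u,v\}$ and $u\circ v=u\cdot d(v)$. A GD algebra $A$ is special if there is a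 differential Poisson algebra $(P,\cdot,\{\,,\},d)$ (of arbitrary, possibly infinite, dimension) such that $A$ is isomorphic to a GD subalgebra of $P^{(d)}$, i.e. there is an injective linear map $A\to P$ preserving $\circ$ and $[\,,]$. *)

(* Defs.v *)
From HB Require Import structures.
From mathcomp Require Import all_boot all_order all_algebra.
From mathcomp Require Import sesquilinear complex reals.

Set Implicit Arguments.
Unset Strict Implicit.
Unset Printing Implicit Defensive.

Import Order.TTheory GRing.Theory Num.Theory.
Local Open Scope ring_scope.

Section Identities.
Variables (V : zmodType).
Implicit Types (f g : V -> V -> V).

Definition jacobi g :=
  forall x y z, g x (g y z) + g y (g z x) + g z (g x y) = 0.

Definition lie_bracket g := (forall x, g x x = 0) /\ jacobi g.

Definition left_symmetric f :=
  forall x y z, f (f x y) z - f x (f y z) = f (f y x) z - f y (f x z).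

Definition novikov_product f := left_symmetric f /\ right_commutative f.

Definition gd_compatible f g := forall x y z,
  g x (f y z) - g z (f y x) + f (g y x) z - f (g y z) x - f y (g x z) = 0.

Definition transposed_leibniz f g := forall x y z,
  f z (g x y) *+ 2 = g (f z x) y + g x (f z y).

Definition poisson_leibniz f g := forall u v w,
  g u (f v w) = f (g u v) w + f v (g u w).

Definition is_derivation (d : V -> V) f :=
  forall u v, d (f u v) = f (d u) v + f u (d v).

End Identities.

(* The algebras below are structures on a given vector space over a field F.  *)
(* Products are bundled bilinear maps, and no unit is required.               *)

Record transposedPoisson (F : fieldType) (A : lmodType F) := TransposedPoisson {
  tp_mul : {bilinear A -> A -> A};
  tp_br : {bilinear A -> A -> A};
  tp_mulC : commutative tp_mul;
  tp_mulA : associative tp_mul;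
  tp_lie : lie_bracket tp_br;
  tp_compat : transposed_leibniz tp_mul tp_br
}.

Record gdAlgebra (F : fieldType) (A : lmodType F) := GDAlgebra {
  gd_circ : {bilinear A -> A -> A};
  gd_br : {bilinear A -> A -> A};
  gd_novikov : novikov_product gd_circ;
  gd_lie : lie_bracket gd_br;
  gd_compat : gd_compatible gd_circ gd_br
}.

Record diffPoisson (F : fieldType) (P : lmodType F) := DiffPoisson {
  dp_mul : {bilinear P -> P -> P};
  dp_br : {bilinear P -> P -> P};
  dp_d : {linear P -> P};
  dp_mulC : commutative dp_mul;
  dp_mulA : associative dp_mul;
  dp_lie : lie_bracket dp_br;
  dp_leibniz : poisson_leibniz dp_mul dp_br;
  dp_d_mul : is_derivation dp_d dp_mul;
  dp_d_br : is_derivation dp_d dp_br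
}.

Lemma lie_antisym (F : fieldType) (A : lmodType F) (g : {bilinear A -> A -> A}) :
  lie_bracket g -> forall x y, g x y = - g y x.
Proof.
move=> [g0 _] x y; apply/eqP; rewrite -addr_eq0; apply/eqP.
have := g0 (x + y).
by rewrite linearDr !linearDl !g0 add0r addr0 addrC.
Qed.

Section TransposedPoissonGD.
Variables (F : numFieldType) (A : lmodType F) (T : transposedPoisson A).
Local Notation m := (tp_mul T).
Local Notation b := (tp_br T).

Lemma tp_novikov : novikov_product m.
Proof.
split=> [x y z|x y z]; first by rewrite !(tp_mulA T) !subrr.
by rewrite -!(tp_mulA T) (tp_mulC T y).
Qed.

Lemma tp_cyclic x y z : m x (b y z) + m y (b z x) + m z (b x y) = 0.
Proof.
have bN := lie_antisym (tp_lie T).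
have h : (m x (b y z) + m y (b z x) + m z (b x y)) *+ 2 = 0.
  rewrite !mulrnDl !(tp_compat T).
  rewrite (tp_mulC T y x) (tp_mulC T z x) (tp_mulC T z y).
  rewrite (bN z (m x y)) (bN (m x z) y) (bN (m y z) x).
  set p := b (m x y) z; set q := b y (m x z); set r := b x (m y z).
  by rewrite (addrC (- r)) (addrACA p) subrr add0r addrACA subrr addNr addr0.
have : (2%:R : F) *: (m x (b y z) + m y (b z x) + m z (b x y)) = 0.
  by rewrite scaler_nat.
by move/eqP; rewrite scaler_eq0 pnatr_eq0 /= => /eqP.
Qed.

Lemma tp_gd_compat : gd_compatible m b.
Proof.
move=> x y z; have bN := lie_antisym (tp_lie T).
have := tp_cyclic x z y; rewrite (bN z y) linearNr.
rewrite (bN z (m y x)) opprK (addrC (b x _)) -(tp_compat T) mulr2n.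
rewrite (tp_mulC T (b y x)) (tp_mulC T (b y z)).
set p := m y (b x z); set q := m z (b y x); set r := m x (b y z) => h.
by rewrite addrAC (addrAC (p + p)) addrK -[RHS]h [RHS]addrC addrA addrAC.
Qed.

Definition gd_of_transposedPoisson : gdAlgebra A :=
  GDAlgebra tp_novikov (tp_lie T) tp_gd_compat.

End TransposedPoissonGD.

Section DiffPoissonGD.
Variables (F : fieldType) (P : lmodType F) (D : diffPoisson P).
Local Notation m := (dp_mul D).
Local Notation b := (dp_br D).
Local Notation d := (dp_d D).

Definition dp_circ (u v : P) : P := m u (d v).

Lemma dp_circ_bilinear : bilinear_for *:%R *:%R dp_circ.
Proof.
split=> [v a u u'|u a v v'] /=; rewrite /dp_circ; first by rewrite linearPl.
by rewrite linearP linearPr.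
Qed.

HB.instance Definition _ :=
  bilinear_isBilinear.Build F P P P _ _ dp_circ dp_circ_bilinear.

Lemma dp_novikov : novikov_product dp_circ.
Proof.
split=> [x y z|x y z]; rewrite /dp_circ; last first.
  by rewrite -!(dp_mulA D) (dp_mulC D (d y)).
rewrite !(dp_d_mul D) !linearDr !opprD !(dp_mulA D) !addrA !subrr !add0r.
by rewrite (dp_mulC D x).
Qed.

Lemma dp_gd_compat : gd_compatible dp_circ b.
Proof.
move=> x y z; have bN := lie_antisym (dp_lie D).
rewrite /dp_circ !(dp_leibniz D) (dp_d_br D) linearDr.
rewrite (bN z y) (bN y x) (bN z (d x)) linearNr !linearNl.
set p := m (b x y) (d z); set q := m y (b x (d z)).
set r := m (b y z) (d x); set s := m y (b (d x) z).
rewrite !opprD !opprK (addrC p q) !addrA.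
by rewrite (addrAC _ s (- p)) (addrAC _ r (- p)) addrK (addrAC _ s (- r)) addrK addrK subrr.
Qed.

Definition gd_of_diffPoisson : gdAlgebra P :=
  @GDAlgebra F P dp_circ b dp_novikov (dp_lie D) dp_gd_compat.

End DiffPoissonGD.

Definition special (F : fieldType) (A : lmodType F) (G : gdAlgebra A) : Prop :=
  exists (P : lmodType F) (D : diffPoisson P) (f : {linear A -> P}),
    [/\ injective f,
        {morph f : x y / gd_circ G x y >-> gd_circ (gd_of_diffPoisson D) x y}
      & {morph f : x y / gd_br G x y >-> gd_br (gd_of_diffPoisson D) x y}].

(* Main.v *)
(* A transposed Poisson algebra is split along its idempotents. For an idempotent
   [e], [A] is the direct sum of the ideals [eA] and [(1 - e)A]; on the unital part
   the bracket is [x (D y) - (D x) y] with [D = [e, -]] a derivation, and [x |-> t x]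
   embeds it into [A[[t]]] with [d = d/dt]. What remains has no idempotent, hence is
   nil. If some [a^3 <> 0], then [A = <a, a^2, a^3>] and an embedding [x |-> t x]
   still exists, the bracket being [C(x, y) - C(y, x)] with [C] a derivation in [x]
   and linear over the algebra in [y]. Otherwise [A^3 = 0], and there is an abelian
   Lie ideal [Z] that contains [A^2] and annihilates [A]; then [A] embeds into
   [A + S + Hom(A/Z, Z)] with [d x] the multiplication by [x], where [S] stands for
   the image of the symmetric square of [A]. *)
Require Import Defs.
From HB Require Import structures.
From mathcomp Require Import all_boot all_order all_algebra.
From mathcomp Require Import boolp functions sesquilinear complex reals ring.

Set Implicit Arguments.
Unset Strict Implicit.
Unset Printing Implicit Defensive.

Import GRing.Theory Num.Theory.
Local Open Scope ring_scope.

(** * Bundled bilinear maps, and vector identities tested on linear forms *)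

Section Bundling.
Variables (F : fieldType) (U V W : lmodType F).

Definition mk_linear (f : U -> V) (H : linear f) : {linear U -> V} :=
  HB.pack_for {linear U -> V} f
    (GRing.isLinear.Build F U V _ f H).

Lemma bilinear_sig (f : U -> V -> W) : bilinear_for *:%R *:%R f ->
  {g : {bilinear U -> V -> W} | forall u v, g u v = f u v}.
Proof.
move=> H; pose g : {bilinear U -> V -> W} := HB.pack_for {bilinear U -> V -> W} f
  (bilinear_isBilinear.Build F U V W _ _ f H).
by exists g.
Qed.

(* Sealed by an opaque proof: unification must not see through the bundled map. *)
Definition mk_bilinear (f : U -> V -> W) (H : bilinear_for *:%R *:%R f) :
  {bilinear U -> V -> W} := sval (bilinear_sig H).

Lemma mk_bilinearE (f : U -> V -> W) (H : bilinear_for *:%R *:%R f) u v :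
  mk_bilinear H u v = f u v.
Proof. exact: (svalP (bilinear_sig H)). Qed.

Lemma bilinear_forI (f : U -> V -> W) :
  (forall a u u' v, f (a *: u + u') v = a *: f u v + f u' v) ->
  (forall a u v v', f u (a *: v + v') = a *: f u v + f u v') ->
  bilinear_for *:%R *:%R f.
Proof. by move=> fl fr; split=> [v a u u'|u a v v']; rewrite ?fl ?fr. Qed.

End Bundling.

(** Linear forms separate points, so an identity between combinations of vectors becomes one between
    scalars, with the values of the form as atoms, and [ring] decides it. *)
Lemma scalar_ext (F : fieldType) (V : vectType F) (x y : V) :
  (forall phi : {scalar V}, phi x = phi y) -> x = y.
Proof.
move=> h; rewrite (coord_vbasis (memvf x)) (coord_vbasis (memvf y)).
by apply: eq_bigr => i _; rewrite h.
Qed.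

Section BilinearRules.
Variables (F : fieldType) (U V W : lmodType F) (f : {bilinear U -> V -> W}).
Lemma bil0l v : f 0 v = 0. Proof. exact: linear0l. Qed.
Lemma bil0r u : f u 0 = 0. Proof. exact: linear0r. Qed.
Lemma bilNl u v : f (- u) v = - f u v. Proof. exact: linearNl. Qed.
Lemma bilNr u v : f u (- v) = - f u v. Proof. exact: linearNr. Qed.
Lemma bilDl u u' v : f (u + u') v = f u v + f u' v. Proof. exact: linearDl. Qed.
Lemma bilDr u v v' : f u (v + v') = f u v + f u v'. Proof. exact: linearDr. Qed.
Lemma bilZl a u v : f (a *: u) v = a *: f u v. Proof. exact: linearZl_LR. Qed.
Lemma bilZr a u v : f u (a *: v) = a *: f u v. Proof. exact: linearZr_LR. Qed.
Lemma bilMnl u v n : f (u *+ n) v = f u v *+ n. Proof. exact: linearMnl. Qed.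
Lemma bilMnr u v n : f u (v *+ n) = f u v *+ n. Proof. exact: linearMnr. Qed.
End BilinearRules.
Definition bilE := (bil0l, bil0r, bilNl, bilNr, bilDl, bilDr, bilZl, bilZr, bilMnl, bilMnr).

Section ScalarRules.
Variables (F : fieldType) (V : lmodType F) (phi : {scalar V}).
Lemma scal0 : phi 0 = 0. Proof. exact: raddf0. Qed.
Lemma scalN u : phi (- u) = - phi u. Proof. exact: raddfN. Qed.
Lemma scalD u v : phi (u + v) = phi u + phi v. Proof. exact: raddfD. Qed.
Lemma scalZ a u : phi (a *: u) = a * phi u. Proof. exact: linearZ. Qed.
Lemma scalMn u n : phi (u *+ n) = phi u *+ n. Proof. exact: raddfMn. Qed.
End ScalarRules.

(* The matching is purely syntactic: [rewrite !scal0] would unify atoms with [0] up to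
   conversion. *)
Ltac push_scalar phi := repeat match goal with
  | |- context [@GRing.Linear.sort _ _ _ _ phi (@Algebra.add _ ?x ?y)] => rewrite (scalD phi x y)
  | |- context [@GRing.Linear.sort _ _ _ _ phi (@Algebra.opp _ ?x)] => rewrite (scalN phi x)
  | |- context [@GRing.Linear.sort _ _ _ _ phi (@GRing.scale _ _ ?a ?x)] => rewrite (scalZ phi a x)
  | |- context [@GRing.Linear.sort _ _ _ _ phi (@Algebra.natmul _ ?x ?n)] => rewrite (scalMn phi x n)
  | |- context [@GRing.Linear.sort _ _ _ _ phi (@Algebra.zero _)] => rewrite (scal0 phi)
  end.
Ltac by_scalars := let phi := fresh "phi" in
  apply: scalar_ext => phi; push_scalar phi; ring.
Ltac by_scalars_fun := apply: funext => ?; rewrite !fctE; by_scalars.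

(** * Hurwitz series and the embedding [x |-> t x] *)

Section Hurwitz.
Variables (F : fieldType) (B : vectType F).
Local Notation H := (nat -> B).
Implicit Types (f g h : H) (beta : {bilinear B -> B -> B}).

Definition shift f : H := fun n => f n.+1.

Lemma shift_is_linear : linear shift. Proof. by []. Qed.
HB.instance Definition _ := GRing.isLinear.Build F H H _ shift shift_is_linear.

Lemma shiftB f g : shift (f - g) = shift f - shift g. Proof. by []. Qed.

(* [f] stands for the series [\sum_n f n *: t ^ n / n!], so that the Leibniz rule for
   [shift = d/dt] computes the coefficients of a product. *)
Fixpoint hlift_fun (beta : B -> B -> B) f g n : B :=
  if n is k.+1 then hlift_fun beta (shift f) g k + hlift_fun beta f (shift g) k
  else beta (f 0%N) (g 0%N).

Lemma hlift_bilinear beta : bilinear_for *:%R *:%R (hlift_fun beta).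
Proof.
apply: bilinear_forI => a u u' v; apply: funext => n.
  rewrite !fctE; elim: n u u' v => [|n IH] u u' v /=; first by rewrite !bilE.
  by rewrite linearP !IH; by_scalars.
rewrite !fctE; elim: n u u' v => [|n IH] u u' v /=; first by rewrite !bilE.
by rewrite linearP !IH; by_scalars.
Qed.

Definition hlift beta : {bilinear H -> H -> H} := mk_bilinear (hlift_bilinear beta).

Lemma hlift0 beta f g : hlift beta f g 0%N = beta (f 0%N) (g 0%N).
Proof. by rewrite mk_bilinearE. Qed.

Lemma shift_hlift beta f g :
  shift (hlift beta f g) = hlift beta (shift f) g + hlift beta f (shift g).
Proof. by rewrite !mk_bilinearE. Qed.

Definition leibniz3 (T : H -> H -> H -> H) := forall f g h,
  shift (T f g h) = T (shift f) g h + T f (shift g) h + T f g (shift h).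

(** Shifting expresses the coefficient of index [n.+1] through coefficients of index [n] of the same
    operation at shifted arguments, so the constant terms determine everything. Identities in three
    arguments thus lift from [B] to series. *)
Lemma leibniz3_ext (T T' : H -> H -> H -> H) : leibniz3 T -> leibniz3 T' ->
  (forall f g h, T f g h 0%N = T' f g h 0%N) -> forall f g h, T f g h = T' f g h.
Proof.
move=> LT LT' h0 f g h; apply: funext => n; elim: n f g h => [|n IH] f g h.
  exact: h0.
rewrite -[LHS]/(shift (T f g h) n) -[RHS]/(shift (T' f g h) n) LT LT'.
by rewrite !fctE !IH.
Qed.

Lemma leibniz3_hliftr beta gamma :
  leibniz3 (fun f g h => hlift beta f (hlift gamma g h)).
Proof. by move=> f g h; rewrite !shift_hlift bilDr addrA. Qed.

Lemma leibniz3_hliftl beta gamma :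
  leibniz3 (fun f g h => hlift beta (hlift gamma f g) h).
Proof. by move=> f g h; rewrite !shift_hlift bilDl. Qed.

Lemma leibniz3B (T T' : H -> H -> H -> H) : leibniz3 T -> leibniz3 T' ->
  leibniz3 (fun f g h => T f g h - T' f g h).
Proof. by move=> LT LT' f g h; rewrite linearB /= LT LT'; by_scalars_fun. Qed.

Lemma leibniz3D (T T' : H -> H -> H -> H) : leibniz3 T -> leibniz3 T' ->
  leibniz3 (fun f g h => T f g h + T' f g h).
Proof. by move=> LT LT' f g h; rewrite linearD /= LT LT'; by_scalars_fun. Qed.

Lemma leibniz3_swap12 (T : H -> H -> H -> H) : leibniz3 T ->
  leibniz3 (fun f g h => T g f h).
Proof. by move=> LT f g h; rewrite LT (addrC (T (shift g) f h)). Qed.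

Lemma leibniz3_swap23 (T : H -> H -> H -> H) : leibniz3 T ->
  leibniz3 (fun f g h => T f h g).
Proof. by move=> LT f g h; rewrite LT addrAC. Qed.
End Hurwitz.

(** * The Poisson bracket on Hurwitz series defined by a product [C] *)

Section TModel.
Variables (F : fieldType) (B : vectType F) (m C : {bilinear B -> B -> B}).
Local Notation H := (nat -> B).
Hypothesis mC : commutative m.
Hypothesis mA : associative m.
Hypothesis C_mulr : forall a b c, C a (m b c) = m (C a b) c.
Hypothesis C_mull : forall a b c, C (m a b) c = m (C a c) b + m a (C b c).
Hypothesis C_comm : forall a b c, C a (C b c) = C b (C a c).
Hypothesis C_lie : forall a b c,
  C a (C b c - C c b) = C (C a b) c - C (C a c) b.

Local Notation M := (hlift m).
Local Notation K := (hlift C).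

Lemma hlift_mulC : commutative M.
Proof.
move=> f g; apply: funext => n.
elim: n f g => [|n IH] f g; first by rewrite !hlift0 mC.
by rewrite -[LHS]/(shift (M f g) n) -[RHS]/(shift (M g f) n) !shift_hlift !fctE
  [in LHS]IH [X in _ + X]IH addrC.
Qed.

Lemma hlift_mulA : associative M.
Proof.
apply: (leibniz3_ext (leibniz3_hliftr m m) (leibniz3_hliftl m m)) => f g h.
by rewrite !hlift0 mA.
Qed.

Lemma hlift_C_mulr f g h : K f (M g h) = M (K f g) h.
Proof.
move: f g h.
apply: (leibniz3_ext (leibniz3_hliftr _ _) (leibniz3_hliftl _ _)) => f g h.
by rewrite !hlift0 C_mulr.
Qed.

Lemma hlift_C_mull f g h : K (M f g) h = M (K f h) g + M f (K g h).
Proof.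
move: f g h.
apply: (leibniz3_ext (leibniz3_hliftl _ _)).
  apply: leibniz3D (leibniz3_hliftr _ _).
  exact: (leibniz3_swap23 (leibniz3_hliftl _ _)).
by move=> f g h; rewrite !fctE !hlift0 C_mull.
Qed.

Lemma hlift_C_comm f g h : K f (K g h) = K g (K f h).
Proof.
move: f g h.
apply: (leibniz3_ext (leibniz3_hliftr _ _)).
  exact: (leibniz3_swap12 (leibniz3_hliftr _ _)).
by move=> f g h; rewrite !hlift0 C_comm.
Qed.

Lemma hlift_C_lie f g h :
  K f (K g h) - K f (K h g) = K (K f g) h - K (K f h) g.
Proof.
move: f g h; apply: leibniz3_ext.
- apply: leibniz3B; first exact: leibniz3_hliftr.
  exact: (leibniz3_swap23 (leibniz3_hliftr _ _)).
- apply: leibniz3B; first exact: leibniz3_hliftl.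
  exact: (leibniz3_swap23 (leibniz3_hliftl _ _)).
by move=> f g h; rewrite !fctE !hlift0 -bilNr -bilDr C_lie.
Qed.

(** On [t x] and [t y] the derivatives are the constants [x] and [y], so this bracket gives
    [t (C x y - C y x)]. *)
Definition hbr_fun (f g : H) : H := K f (shift g) - K g (shift f).

Lemma hbr_bilinear : bilinear_for *:%R *:%R hbr_fun.
Proof.
apply: bilinear_forI => a u u' v; rewrite /hbr_fun [shift (_ + _)]linearP !bilE.
  by by_scalars_fun.
by by_scalars_fun.
Qed.

Definition hbr : {bilinear H -> H -> H} := mk_bilinear hbr_bilinear.

Lemma hbrE f g : hbr f g = K f (shift g) - K g (shift f).
Proof. exact: mk_bilinearE. Qed.

(** Write [f'] for the shift of [f]. In the cyclic sum, terms with a second derivative such as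
    [K f (K g h'')] cancel in pairs because the operators [K f] and [K g] commute. The terms with
    two first derivatives cancel by [hlift_C_lie]. *)
Lemma hbr_lie : lie_bracket hbr.
Proof.
split=> [f|f g h]; first by rewrite hbrE subrr.
have lieE u v w := canRL (subrK _) (hlift_C_lie u v w).
rewrite !hbrE !shiftB !shift_hlift !(bilDr, bilNr, bilDl, bilNl).
rewrite (lieE f (shift g)) (lieE g (shift h)) (lieE h (shift f)).
rewrite (hlift_C_comm g f) (hlift_C_comm h f) (hlift_C_comm h g).
apply: funext => n; rewrite !fctE; transitivity (0 : B) => //; by_scalars.
Qed.

Lemma hbr_leibniz : poisson_leibniz M hbr.
Proof.
move=> u v w; rewrite !hbrE shift_hlift bilDr hlift_C_mull hlift_C_mulr.
rewrite (hlift_mulC v (shift w)) hlift_C_mulr (hlift_mulC (K u (shift w))).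
by rewrite (bilDl M) (bilDr M) (bilNl M) (bilNr M); by_scalars_fun.
Qed.

Lemma shift_hbr : is_derivation (@shift F B) hbr.
Proof. by move=> u v; rewrite !hbrE shiftB !shift_hlift; by_scalars_fun. Qed.

Definition hurwitz_diffPoisson : diffPoisson H :=
  @DiffPoisson F H M hbr (@shift F B) hlift_mulC hlift_mulA hbr_lie hbr_leibniz
    (shift_hlift m) shift_hbr.

Definition at_exponent k (a : B) : H := fun n => if n == k then a else 0.

Lemma at_exponent_linear k : linear (at_exponent k).
Proof.
move=> a u v; apply: funext => n; rewrite !fctE /at_exponent.
by case: eqP => //; rewrite scaler0 addr0.
Qed.

Lemma shift_at_exponent0 a : shift (at_exponent 0 a) = 0. Proof. by []. Qed.
Lemma shift_at_exponent1 a : shift (at_exponent 1 a) = at_exponent 0 a.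
Proof. by []. Qed.

Lemma hlift_exponent00 beta a b :
  hlift beta (at_exponent 0 a) (at_exponent 0 b) = at_exponent 0 (beta a b).
Proof.
apply: funext => -[|n]; first by rewrite hlift0.
rewrite -[LHS]/(shift (hlift beta _ _) n) shift_hlift !shift_at_exponent0.
by rewrite !bilE addr0.
Qed.

Lemma hlift_exponent10 beta a b :
  hlift beta (at_exponent 1 a) (at_exponent 0 b) = at_exponent 1 (beta a b).
Proof.
apply: funext => -[|n]; first by rewrite hlift0 /at_exponent /= !bilE.
rewrite -[LHS]/(shift (hlift beta _ _) n) shift_hlift !shift_at_exponent0.
by rewrite shift_at_exponent1 !bilE addr0 hlift_exponent00.
Qed.

End TModel.

(** * Homomorphisms to differential Poisson algebras and to their products *)

Section GDHom.
Variables (F : numFieldType) (A : lmodType F) (T : transposedPoisson A).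

Definition gd_hom (P : lmodType F) (D : diffPoisson P) (f : A -> P) : Prop :=
  (forall x y, f (tp_mul T x y) = dp_mul D (f x) (dp_d D (f y))) /\
  (forall x y, f (tp_br T x y) = dp_br D (f x) (f y)).

Lemma special_of_hom (P : lmodType F) (D : diffPoisson P) (f : {linear A -> P}) :
  gd_hom D f -> (forall a, f a = 0 -> a = 0) -> special (gd_of_transposedPoisson T).
Proof.
move=> [fM fB] f_inj; exists P, D, f; split=> [x y fxy|//|//].
by apply/eqP; rewrite -subr_eq0; apply/eqP/f_inj; rewrite linearB /= fxy subrr.
Qed.

End GDHom.

Section ProductDiffPoisson.
Variables (F : fieldType) (P Q : lmodType F) (D : diffPoisson P) (E : diffPoisson Q).

Definition pair_op (f : P -> P -> P) (g : Q -> Q -> Q) (u v : P * Q) : P * Q :=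
  (f u.1 v.1, g u.2 v.2).

Lemma pair_op_bilinear (f : {bilinear P -> P -> P}) (g : {bilinear Q -> Q -> Q}) :
  bilinear_for *:%R *:%R (pair_op f g).
Proof.
by apply: bilinear_forI => a [u1 u2] [v1 v2] [w1 w2]; rewrite /pair_op /= !bilE.
Qed.

Definition pair_d (u : P * Q) : P * Q := (dp_d D u.1, dp_d E u.2).

Lemma pair_d_linear : linear pair_d.
Proof. by move=> a [u1 u2] [v1 v2]; rewrite /pair_d /= !linearP. Qed.

Local Notation pmul := (mk_bilinear (pair_op_bilinear (dp_mul D) (dp_mul E))).
Local Notation pbr := (mk_bilinear (pair_op_bilinear (dp_br D) (dp_br E))).

Lemma pair_mulC : commutative pmul.
Proof. by move=> u v; rewrite !mk_bilinearE; congr (_, _); apply: dp_mulC. Qed.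

Lemma pair_mulA : associative pmul.
Proof. by move=> u v w; rewrite !mk_bilinearE; congr (_, _); apply: dp_mulA. Qed.

Lemma pair_lie : lie_bracket pbr.
Proof.
split=> [u|u v w]; rewrite !mk_bilinearE.
  by congr (_, _); apply: (dp_lie _).1.
by congr (_, _); apply: (dp_lie _).2.
Qed.

Lemma pair_leibniz : poisson_leibniz pmul pbr.
Proof. by move=> u v w; rewrite !mk_bilinearE; congr (_, _); apply: dp_leibniz. Qed.

Lemma pair_d_mul : is_derivation (mk_linear pair_d_linear) pmul.
Proof. by move=> u v; rewrite !mk_bilinearE; congr (_, _); apply: dp_d_mul. Qed.

Lemma pair_d_br : is_derivation (mk_linear pair_d_linear) pbr.
Proof. by move=> u v; rewrite !mk_bilinearE; congr (_, _); apply: dp_d_br. Qed.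

Definition pair_diffPoisson : diffPoisson (P * Q)%type :=
  DiffPoisson pair_mulC pair_mulA pair_lie pair_leibniz pair_d_mul pair_d_br.

End ProductDiffPoisson.

(** Neither homomorphism has to be injective: it suffices that their kernels meet in zero, since the
    pair then embeds [A] into the product. *)
Lemma special_of_hom2 (F : numFieldType) (A : lmodType F) (T : transposedPoisson A)
    (P Q : lmodType F) (D : diffPoisson P) (E : diffPoisson Q)
    (f : {linear A -> P}) (g : {linear A -> Q}) :
  gd_hom T D f -> gd_hom T E g -> (forall a, f a = 0 -> g a = 0 -> a = 0) ->
  special (gd_of_transposedPoisson T).
Proof.
move=> [fM fB] [gM gB] fg_inj.
have lin : linear (fun a => (f a, g a) : P * Q) by move=> a u v; rewrite !linearP.
apply: (@special_of_hom _ _ _ _ (pair_diffPoisson D E) (mk_linear lin)).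
  by split=> x y; rewrite /= ?fM ?gM ?fB ?gB mk_bilinearE.
by move=> a [/fg_inj]; apply.
Qed.

(** * The homomorphism [x |-> t (g x)] *)

Section TModelHom.
Variables (F : numFieldType) (A : lmodType F) (T : transposedPoisson A).
Variables (B : vectType F) (m C : {bilinear B -> B -> B}) (g : {linear A -> B}).
Hypothesis mC : commutative m.
Hypothesis mA : associative m.
Hypothesis C_mulr : forall a b c, C a (m b c) = m (C a b) c.
Hypothesis C_mull : forall a b c, C (m a b) c = m (C a c) b + m a (C b c).
Hypothesis C_comm : forall a b c, C a (C b c) = C b (C a c).
Hypothesis C_lie : forall a b c,
  C a (C b c - C c b) = C (C a b) c - C (C a c) b.
Hypothesis gM : forall x y, g (tp_mul T x y) = m (g x) (g y).
Hypothesis gB : forall x y, g (tp_br T x y) = C (g x) (g y) - C (g y) (g x).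

Lemma tmodel_linear : linear (fun x => at_exponent 1 (g x)).
Proof. by move=> a u v; rewrite linearP at_exponent_linear. Qed.

(** Each term of [f * f'] type, in the product as in the bracket, differentiates exactly one of its
    two arguments. Of the two factors [t] one survives, so the exponent 1 is preserved. *)
Lemma tmodel_hom :
  gd_hom T (hurwitz_diffPoisson mC mA C_mulr C_mull C_comm C_lie)
    (mk_linear tmodel_linear).
Proof.
split=> x y; rewrite -[LHS]/(at_exponent 1 (g _)).
  rewrite -[RHS]/(hlift m (at_exponent 1 (g x)) (shift (at_exponent 1 (g y)))).
  by rewrite shift_at_exponent1 hlift_exponent10 gM.
rewrite -[RHS]/(hbr C (at_exponent 1 (g x)) (at_exponent 1 (g y))).
rewrite hbrE !shift_at_exponent1 !hlift_exponent10 gB.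
by rewrite -[in LHS]scaleN1r addrC at_exponent_linear scaleN1r addrC.
Qed.

Lemma tmodel_inj x : at_exponent 1 (g x) = 0 -> g x = 0.
Proof. by move/(congr1 (fun u => u 1%N)). Qed.

End TModelHom.

(** * Algebras with [A ^ 3 = 0] *)

Section LfunRules.
Variables (F : fieldType) (U V : vectType F) (f : 'Hom(U, V)).
Lemma lf0 : f 0 = 0. Proof. exact: linear0. Qed.
Lemma lfD u v : f (u + v) = f u + f v. Proof. exact: linearD. Qed.
Lemma lfB u v : f (u - v) = f u - f v. Proof. exact: linearB. Qed.
Lemma lfP a u v : f (a *: u + v) = a *: f u + f v. Proof. exact: linearP. Qed.
End LfunRules.

Section ThreeStep.
Variables (F : numFieldType) (A : vectType F) (T : transposedPoisson A) (p : 'End(A)).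
Local Notation m := (tp_mul T).
Local Notation b := (tp_br T).
(* [p] projects onto [Z]; a map [c] only enters through [ap c = p \o c \o (1 - p)],
   so that ['End(A)] plays the role of [Hom(A/Z, Z)]. *)
Hypothesis pp : forall z, p (p z) = p z.
Hypothesis p_mul : forall x y, p (m x y) = m x y.
Hypothesis mul_p : forall x z, m x (p z) = 0.
Hypothesis p_br : forall x z, p (b x (p z)) = b x (p z).
Hypothesis br_pp : forall y z, b (p y) (p z) = 0.
Local Notation End := 'End(A).
(* An element [s] of [S] is given by [d s = s.1] and the brackets [{s, c} = s.2 c]. *)
Local Notation S := (A * 'Hom('End(A), A))%type.

Lemma ap_bilinear :
  bilinear_for *:%R *:%R (fun (c : End) (x : A) => p (c (x - p x))).
Proof.
apply: bilinear_forI => a c u v; first by rewrite add_lfunE scale_lfunE lfP.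
rewrite -!lfP; congr (p (c _)); rewrite lfP.
by rewrite scalerBr opprD addrACA.
Qed.
Definition ap := mk_bilinear ap_bilinear.

Lemma apE c x : ap c x = p (c (x - p x)). Proof. exact: mk_bilinearE. Qed.

Lemma p_ap c x : p (ap c x) = ap c x. Proof. by rewrite apE pp. Qed.
Lemma ap_p c z : ap c (p z) = 0.
Proof. by rewrite apE pp subrr !linear0. Qed.
Lemma ap_subp c x : ap c (x - p x) = ap c x.
Proof. by rewrite bilDr bilNr ap_p subr0. Qed.

Lemma ap_linear c : linear (ap c).
Proof. by move=> a x y; rewrite bilDr bilZr. Qed.

(** The representative of the class of [c] that vanishes on [Z] and has values in [Z]. Evaluating
    elements of [S] at it makes the result depend on [ap c] only. *)
Definition trunc (c : End) : End := linfun (mk_linear (ap_linear c)).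

Lemma truncE c x : trunc c x = ap c x. Proof. exact: lfunE. Qed.

Lemma ap_trunc c x : ap (trunc c) x = ap c x.
Proof. by rewrite apE truncE p_ap ap_subp. Qed.

Lemma trunc_ext c c' : ap c =1 ap c' -> trunc c = trunc c'.
Proof. by move=> h; apply/lfunP => x; rewrite !truncE h. Qed.

Lemma lam_linearr x : linear (m x).
Proof. by move=> a y z; rewrite bilDr bilZr. Qed.
Definition lam (x : A) : End := linfun (mk_linear (lam_linearr x)).

Lemma lamE x y : lam x y = m x y. Proof. exact: lfunE. Qed.

Lemma lam_linear : linear lam.
Proof.
by move=> a x y; apply/lfunP => z; rewrite add_lfunE scale_lfunE !lamE bilDl bilZl.
Qed.

Lemma ap_lam x y : ap (lam x) y = m x y.
Proof. by rewrite apE lamE bilDr bilNr mul_p subr0 p_mul. Qed.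

Lemma lam_p z : lam (p z) = 0.
Proof. by apply/lfunP => x; rewrite lamE (tp_mulC T) mul_p zero_lfunE. Qed.

Lemma act_linearr x c : linear (fun y => b x (ap c y) - ap c (b x y)).
Proof. by move=> a y z; rewrite !(bilDr, bilZr); by_scalars. Qed.
(** The bracket [{x, c}]: [A] acts on [Hom(A/Z, Z)] by commutators with [b x]. *)
Definition act_fun x c : End := linfun (mk_linear (act_linearr x c)).

Lemma act_funE x c y : act_fun x c y = b x (ap c y) - ap c (b x y).
Proof. exact: lfunE. Qed.

Lemma act_bilinear : bilinear_for *:%R *:%R act_fun.
Proof.
apply: bilinear_forI => a u u' v; apply/lfunP => y;
  rewrite add_lfunE scale_lfunE !act_funE !(bilDl, bilZl, bilDr, bilZr);
  by_scalars.
Qed.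
Definition act := mk_bilinear act_bilinear.

Lemma actE x c y : act x c y = b x (ap c y) - ap c (b x y).
Proof. rewrite -act_funE; congr (fun_of_lfun _ _); exact: mk_bilinearE. Qed.

Lemma ap_act x c y : ap (act x c) y = b x (ap c y) - ap c (b x y).
Proof.
rewrite apE actE ap_subp lfB p_ap -(p_ap c y) p_br; congr (_ - _).
by rewrite bilDr bilNr -p_br bilDr bilNr ap_p subr0.
Qed.

Lemma act_p z c : act (p z) c = 0.
Proof.
apply/lfunP => y; rewrite actE zero_lfunE -p_ap br_pp sub0r.
by rewrite (lie_antisym (tp_lie T)) -p_br bilNr ap_p !oppr0.
Qed.

Lemma val_bilinear :
  bilinear_for *:%R *:%R (fun (s : 'Hom(End, A)) (c : End) => p (s (trunc c))).
Proof.
apply: bilinear_forI => a s s' c.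
  by rewrite add_lfunE scale_lfunE lfP.
rewrite -!lfP; congr (p (s _)); apply/lfunP => x.
by rewrite add_lfunE scale_lfunE !truncE bilDl bilZl.
Qed.
Definition val := mk_bilinear val_bilinear.

Lemma valE s c : val s c = p (s (trunc c)). Proof. exact: mk_bilinearE. Qed.
Lemma p_val s c : p (val s c) = val s c. Proof. by rewrite valE pp. Qed.
Lemma val_ext s c c' : ap c =1 ap c' -> val s c = val s c'.
Proof. by move/trunc_ext => e; rewrite !valE e. Qed.

Lemma S_ext (s s' : S) : s.1 = s'.1 -> (forall c, s.2 c = s'.2 c) -> s = s'.
Proof. by case: s s' => [s1 s2] [s1' s2'] /= -> /lfunP ->. Qed.

Lemma S_comb1 k (s s' : S) : (k *: s + s').1 = k *: s.1 + s'.1.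
Proof. by []. Qed.

Lemma S_comb2 k (s s' : S) c : (k *: s + s').2 c = k *: s.2 c + s'.2 c.
Proof. by rewrite /= add_lfunE scale_lfunE. Qed.

Lemma sig_linearr x y : linear (fun c => b x (ap c y) + b y (ap c x)).
Proof. by move=> a c c'; rewrite !(bilDl, bilDr, bilZl, bilZr); by_scalars. Qed.
(** The product of [x] and [y] in the large algebra; both components are forced. The first is
    [d (x y) = x (d y) + y (d x)]. The second is [{x y, c} = x {y, c} + y {x, c}], in which the
    terms [ap c (b x y)] and [ap c (b y x)] cancel. *)
Definition sig_fun x y : S := (m x y *+ 2, linfun (mk_linear (sig_linearr x y))).

Lemma sig_fun1 x y : (sig_fun x y).1 = m x y *+ 2. Proof. by []. Qed.
Lemma sig_fun2 x y c : (sig_fun x y).2 c = b x (ap c y) + b y (ap c x).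
Proof. exact: lfunE. Qed.

Lemma sig_bilinear : bilinear_for *:%R *:%R sig_fun.
Proof.
apply: bilinear_forI => a u u' v; apply: S_ext => [|c];
  rewrite ?S_comb1 ?S_comb2 ?sig_fun1 ?sig_fun2 ?(bilDl, bilZl, bilDr, bilZr); by_scalars.
Qed.
Definition sig := mk_bilinear sig_bilinear.
Lemma sig1 x y : (sig x y).1 = m x y *+ 2. Proof. by rewrite mk_bilinearE. Qed.
Lemma sig2 x y c : (sig x y).2 c = b x (ap c y) + b y (ap c x).
Proof. by rewrite mk_bilinearE sig_fun2. Qed.

Lemma val_sig x y c : val (sig x y).2 c = b x (ap c y) + b y (ap c x).
Proof. by rewrite valE sig2 !ap_trunc lfD -(p_ap c y) -(p_ap c x) !p_br. Qed.

Lemma sigC x y : sig x y = sig y x.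
Proof.
by apply: S_ext => [|c]; rewrite ?sig1 ?sig2 1?(tp_mulC T) // addrC.
Qed.

Lemma sig_p x z : sig x (p z) = 0.
Proof.
apply: S_ext => [|c]; first by rewrite sig1 mul_p mul0rn.
by rewrite sig2 ap_p bil0r add0r -p_ap br_pp zero_lfunE.
Qed.

Lemma actS_linearr x (s : S) : linear (fun c => b x (val s.2 c) - val s.2 (act x c)).
Proof. by move=> a c c'; rewrite !(bilDl, bilDr, bilZl, bilZr); by_scalars. Qed.
(** The second component is prescribed by the Jacobi identity:
    [{{x, s}, c} = {x, {s, c}} - {s, {x, c}}]. *)
Definition actS_fun x (s : S) : S :=
  (b x (p s.1) - val s.2 (lam x), linfun (mk_linear (actS_linearr x s))).

Lemma actS_fun1 x s : (actS_fun x s).1 = b x (p s.1) - val s.2 (lam x).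
Proof. by []. Qed.
Lemma actS_fun2 x s c : (actS_fun x s).2 c = b x (val s.2 c) - val s.2 (act x c).
Proof. exact: lfunE. Qed.

Lemma actS_bilinear : bilinear_for *:%R *:%R actS_fun.
Proof.
apply: bilinear_forI => a u u' v; apply: S_ext => [|c];
  rewrite ?S_comb1 ?S_comb2 ?actS_fun1 ?actS_fun2 ?lam_linear ?S_comb1 ?lfP
    ?(bilDl, bilZl, bilDr, bilZr); by_scalars.
Qed.
(* The bracket [{x, s}]; its first component is forced by [d {x, s} = {lam x, s} + {x, d s}]. *)
Definition actS := mk_bilinear actS_bilinear.
Lemma actS1 x s : (actS x s).1 = b x (p s.1) - val s.2 (lam x).
Proof. by rewrite mk_bilinearE. Qed.
Lemma actS2 x s c : (actS x s).2 c = b x (val s.2 c) - val s.2 (act x c).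
Proof. by rewrite mk_bilinearE actS_fun2. Qed.

Lemma val_actS x s c : val (actS x s).2 c = b x (val s.2 c) - val s.2 (act x c).
Proof.
rewrite valE actS2 lfB (@val_ext _ (trunc c) c); last exact: ap_trunc.
rewrite (@val_ext _ (act x (trunc c)) (act x c)) ?p_val.
  by rewrite -(p_val _ c) p_br.
by move=> y; rewrite !ap_act !ap_trunc.
Qed.

Lemma actS_p z s : actS (p z) s = 0.
Proof.
apply: S_ext => [|c]; first by rewrite actS1 br_pp lam_p bil0r subr0.
by rewrite actS2 act_p bil0r subr0 -p_val br_pp zero_lfunE.
Qed.

Lemma br_der x y z : b x (b y z) = b (b x y) z + b y (b x z).
Proof.
have bN := lie_antisym (tp_lie T).
have := (tp_lie T).2 x y z.
rewrite (bN z (b x y)) (bN z x) bilNr => /eqP; rewrite subr_eq0 subr_eq => /eqP.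
by [].
Qed.

Lemma act_br x y c : act (b x y) c = act x (act y c) - act y (act x c).
Proof.
apply/lfunP => u; rewrite add_lfunE opp_lfunE !actE !ap_act.
by rewrite !(bilDr, bilNr) (br_der x y u) (br_der x y (ap c u)) bilDr; by_scalars.
Qed.

(** This is [d {x, y} = {d x, y} + {x, d y}] on [A]. At [u], the transposed Leibniz rule turns the
    right side into [2 u [x, y] + x [y, u] + y [u, x]], and by the cyclic identity the last two
    terms sum to [- u [x, y]]. *)
Lemma act_lam x y : lam (b x y) = act x (lam y) - act y (lam x).
Proof.
have bN := lie_antisym (tp_lie T).
apply/lfunP => u; rewrite add_lfunE opp_lfunE !actE !ap_lam !lamE.
have e1 : b x (m u y) = m u (b x y) *+ 2 - b (m u x) y.
  by rewrite (tp_compat T) addrC addKr.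
have e2 : m u (b x y) = - m x (b y u) - m y (b u x).
  by apply/eqP; rewrite -subr_eq0 opprD !opprK addrA addrC addrA (tp_cyclic T).
rewrite (tp_mulC T (b x y)) (tp_mulC T y u) e1 (bN y) (tp_mulC T x u) e2.
by rewrite (bN u x) bilNr; by_scalars.
Qed.

Lemma actS_br x y s : actS (b x y) s = actS x (actS y s) - actS y (actS x s).
Proof.
apply: S_ext => [|c].
  rewrite -[RHS]/((actS x (actS y s)).1 - (actS y (actS x s)).1) !actS1.
  rewrite !lfB !p_br !p_val !val_actS act_lam !(bilDr, bilNr).
  by rewrite (br_der x y (p s.1)); by_scalars.
rewrite -[RHS]/(((actS x (actS y s)).2 - (actS y (actS x s)).2) c).
rewrite add_lfunE opp_lfunE !actS2 !val_actS act_br !(bilDr, bilNr).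
by rewrite (br_der x y (val s.2 c)); by_scalars.
Qed.

(** The Leibniz rule for [{x, y z}]. Its first component is the sum of two instances of the
    transposed Leibniz rule. *)
Lemma actS_sig x y z : actS x (sig y z) = sig (b x y) z + sig y (b x z).
Proof.
apply: S_ext => [|c].
  rewrite -[RHS]/((sig (b x y) z).1 + (sig y (b x z)).1) !actS1 val_sig !ap_lam !sig1.
  rewrite raddfMn /= p_mul bilMnr (tp_mulC T (b x y)) !(tp_compat T).
  rewrite (tp_mulC T z x) (tp_mulC T z y) (tp_mulC T y x).
  rewrite (lie_antisym (tp_lie T) y) (lie_antisym (tp_lie T) z); by_scalars.
rewrite -[RHS]/(((sig (b x y) z).2 + (sig y (b x z)).2) c).
rewrite add_lfunE !actS2 !val_sig !sig2 !ap_act !(bilDr, bilNr) !(br_der x).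
by_scalars.
Qed.

Lemma valS_bilinear :
  bilinear_for *:%R *:%R (fun (s : S) (c : End) => val s.2 c).
Proof.
apply: bilinear_forI => k u u' v; last by rewrite bilDr bilZr.
by rewrite -[(_ + _).2]/(k *: u.2 + u'.2) bilDl bilZl.
Qed.
Definition valS := mk_bilinear valS_bilinear.
Lemma valSE s c : valS s c = val s.2 c. Proof. exact: mk_bilinearE. Qed.

Lemma valS_sig x y c : valS (sig x y) c = b x (ap c y) + b y (ap c x).
Proof. by rewrite !valSE val_sig. Qed.
Lemma valS_actS x s c : valS (actS x s) c = b x (valS s c) - valS s (act x c).
Proof. by rewrite !valSE val_actS. Qed.
Lemma p_valS s c : p (valS s c) = valS s c. Proof. by rewrite !valSE p_val. Qed.

Local Notation P := (A * S * End)%type.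

Definition pmul_fun (u v : P) : P :=
  (ap v.2 u.1.1 + ap u.2 v.1.1, sig u.1.1 v.1.1, 0).
Definition pbr_fun (u v : P) : P :=
  (b u.1.1 v.1.1 + valS u.1.2 v.2 - valS v.1.2 u.2,
   actS u.1.1 v.1.2 - actS v.1.1 u.1.2, act u.1.1 v.2 - act v.1.1 u.2).
Definition pd_fun (u : P) : P := (p u.1.2.1, 0, lam u.1.1).

Lemma paddE (x : A) (s : S) (c : End) y t e :
  (x, s, c) + (y, t, e) = (x + y, s + t, c + e).
Proof. by []. Qed.
Lemma pscaleE k (x : A) (s : S) (c : End) : k *: (x, s, c) = (k *: x, k *: s, k *: c).
Proof. by []. Qed.

Lemma pmul_bilinear : bilinear_for *:%R *:%R pmul_fun.
Proof.
apply: bilinear_forI => k [[x s] c] [[y t] e] [[z r] f];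
  rewrite /pmul_fun !(pscaleE, paddE); cbn [fst snd];
  rewrite ?(pscaleE, paddE) !(bilDl, bilZl, bilDr, bilZr) scaler0 addr0;
  by congr (_, _, _); cbn [fst snd]; by_scalars.
Qed.
Definition pmul := mk_bilinear pmul_bilinear.
Lemma pmulE x s c y t e :
  pmul (x, s, c) (y, t, e) = (ap e x + ap c y, sig x y, 0).
Proof. exact: mk_bilinearE. Qed.

Lemma pbr_bilinear : bilinear_for *:%R *:%R pbr_fun.
Proof.
apply: bilinear_forI => k [[x s] c] [[y t] e] [[z r] f];
  rewrite /pbr_fun !(pscaleE, paddE); cbn [fst snd];
  rewrite ?(pscaleE, paddE) !(bilDl, bilZl, bilDr, bilZr);
  by congr (_, _, _); cbn [fst snd]; by_scalars.
Qed.
Definition pbr := mk_bilinear pbr_bilinear.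
Lemma pbrE x s c y t e : pbr (x, s, c) (y, t, e) =
  (b x y + valS s e - valS t c, actS x t - actS y s, act x e - act y c).
Proof. exact: mk_bilinearE. Qed.

Lemma pd_linear : linear pd_fun.
Proof.
move=> k [[x s] c] [[y t] e]; rewrite /pd_fun !(pscaleE, paddE); cbn [fst snd].
rewrite ?(pscaleE, paddE) lam_linear S_comb1 lfP.
by rewrite scaler0 addr0.
Qed.
Definition pd := mk_linear pd_linear.
Lemma pdE x s c : pd (x, s, c) = (p s.1, 0, lam x). Proof. by []. Qed.

Lemma pmulC : commutative pmul.
Proof. by move=> [[x s] c] [[y t] e]; rewrite [LHS]pmulE [RHS]pmulE sigC addrC. Qed.

(** All products of three elements vanish: a product lies in [Z + S], and both [Z] and [S] multiply
    everything to zero. *)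
Lemma pmulA : associative pmul.
Proof.
move=> [[x s] c] [[y t] e] [[z r] f].
rewrite !pmulE.
rewrite -(p_ap f y) -(p_ap e z) -(p_ap e x) -(p_ap c y) -!lfD.
by rewrite !ap_p !bil0l (sigC (p _) z) !sig_p addr0.
Qed.

(** The values of [valS] lie in [Z], which acts by zero on [S] and on the maps. What remains is that
    [act] and [actS] are representations of the Lie algebra [A] and that [valS] is equivariant. *)
Lemma pbr_lie : lie_bracket pbr.
Proof.
split=> [[[x s] c]|[[x s] c] [[y t] e] [[z r] f]].
  by rewrite pbrE !subrr (tp_lie T).1 add0r subrr.
rewrite -[RHS]/((0, 0, 0) : P).
rewrite !pbrE !paddE.
have ap0 s' c' : actS (valS s' c') = (fun _ => 0) :> (S -> S).
  by apply: funext => w; rewrite -p_valS actS_p.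
have av0 s' c' : act (valS s' c') = (fun _ => 0) :> (End -> End).
  by apply: funext => w; rewrite -p_valS act_p.
congr (_, _, _); cbn [fst snd].
- rewrite !(bilDl, bilDr, bilNl, bilNr) !valS_actS.
  rewrite (br_der x y z) (lie_antisym (tp_lie T) z (b x y)).
  rewrite (lie_antisym (tp_lie T) z x) bilNr; by_scalars.
- rewrite !(bilDl, bilDr, bilNl, bilNr) !ap0 !actS_br; by_scalars.
- rewrite !(bilDl, bilDr, bilNl, bilNr) !av0 !act_br; by_scalars.
Qed.

Lemma pbr_leibniz : poisson_leibniz pmul pbr.
Proof.
move=> [[x s] c] [[y t] e] [[z r] f].
rewrite !(pmulE, pbrE) paddE.
congr (_, _, _); cbn [fst snd].
- rewrite !(bilDl, bilDr, bilNl, bilNr, bil0r) valS_sig !ap_act.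
  rewrite -(p_valS s e) -(p_valS t c) -(p_valS s f) -(p_valS r c) !ap_p.
  rewrite (lie_antisym (tp_lie T) z y) bilNr; by_scalars.
- rewrite actS_sig (bilDl actS) -(p_ap f) -(p_ap e) !actS_p addr0 subr0.
  rewrite !(bilDl, bilDr, bilNl, bilNr).
  rewrite -(p_valS s e) -(p_valS t c) -(p_valS s f) -(p_valS r c).
  by rewrite (sigC (p (valS s e))) (sigC (p (valS t c))) !sig_p; by_scalars.
- by rewrite bil0r (bilDl act) -(p_ap f) -(p_ap e) !act_p !addr0 subr0.
Qed.

Lemma pd_mul : is_derivation pd pmul.
Proof.
move=> [[x s] c] [[y t] e].
rewrite !(pmulE, pdE) paddE.
congr (_, _, _); cbn [fst snd].
- by rewrite !ap_p !ap_lam sig1 raddfMn /= p_mul mulr2n add0r addr0 (tp_mulC T y).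
- by rewrite sigC !sig_p addr0.
- by rewrite -(p_ap e) -(p_ap c) -lfD lam_p addr0.
Qed.

Lemma pd_br : is_derivation pd pbr.
Proof.
move=> [[x s] c] [[y t] e].
rewrite !(pbrE, pdE) paddE.
congr (_, _, _); cbn [fst snd].
- rewrite -[(actS x t - actS y s).1]/((actS x t).1 - (actS y s).1) !actS1 !lfB.
  rewrite !p_br !p_val !bil0l (lie_antisym (tp_lie T) _ y).
  rewrite -!valSE; by_scalars.
- by rewrite !actS_p !bil0r !subr0 addr0.
- have lamD : lam (b x y + p (valS s e - valS t c)) = lam (b x y).
    by have := lam_linear 1 (b x y) (p (valS s e - valS t c));
       rewrite !scale1r lam_p addr0.
  rewrite !act_p -addrA -(p_valS s e) -(p_valS t c) -lfB lamD act_lam.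
  by rewrite !sub0r subr0 addrC.
Qed.

Definition three_step_diffPoisson : diffPoisson P :=
  @DiffPoisson F P pmul pbr pd pmulC pmulA pbr_lie pbr_leibniz pd_mul pd_br.

Lemma three_step_linear : linear (fun x : A => (x, 0, 0) : P).
Proof. by move=> k x y; rewrite pscaleE paddE !scaler0 !addr0. Qed.

(** On the copy of [A] one has [x * d y = x * lam y = ap (lam y) x], which is the product [y x] of
    [A]. *)
Lemma three_step_special : special (gd_of_transposedPoisson T).
Proof.
apply: (@special_of_hom _ _ _ _ three_step_diffPoisson (mk_linear three_step_linear)).
  split=> x y; rewrite -[LHS]/(_, 0, 0).
    rewrite -[RHS]/(pmul (x, 0, 0) (pd (y, 0, 0))) [pd _]pdE lf0 [RHS]pmulE.
    by rewrite ap_lam bil0l bil0r addr0 (tp_mulC T).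
  rewrite -[RHS]/(pbr (x, 0, 0) (y, 0, 0)) [RHS]pbrE.
  by rewrite !bil0l !bil0r !subr0 addr0.
by move=> x [].
Qed.
End ThreeStep.

(** * Splitting off an idempotent *)

Lemma mulr2_inj (F : numFieldType) (V : lmodType F) (x y : V) :
  x *+ 2 = y *+ 2 -> x = y.
Proof.
rewrite -!scaler_nat => /(congr1 (fun z => 2%:R^-1 *: z)).
by rewrite !scalerA mulVf ?pnatr_eq0 // !scale1r.
Qed.

Section Idempotent.
Variables (F : numFieldType) (A : vectType F) (T : transposedPoisson A) (e : A).
Local Notation m := (tp_mul T).
Local Notation b := (tp_br T).
Hypothesis ee : m e e = e.
Let mC : commutative m := tp_mulC T.
Let mA : associative m := tp_mulA T.
Let bN := lie_antisym (tp_lie T).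

Lemma idem_mulK x : m e (m e x) = m e x. Proof. by rewrite mA ee. Qed.

Lemma idem_comm x y : m e (m x y) = m x (m e y).
Proof. by rewrite !mA (mC e). Qed.

Lemma idem_mul2 x y : m (m e x) (m e y) = m e (m x y).
Proof. by rewrite -mA -idem_comm idem_mulK. Qed.

(** The ideals [eA] and [(1 - e)A] commute. For such a bracket [z] the transposed Leibniz rule gives
    [2 e z = z]; multiplying by [e] gives [e z = 0], hence [z = 0]. *)
Lemma br_idem_compl x y : b (m e x) (y - m e y) = 0.
Proof.
set z := b _ _; have zE : m e z *+ 2 = z.
  rewrite (tp_compat T) idem_mulK (bilDr m) (bilNr m) idem_mulK subrr.
  by rewrite bil0r addr0.
have := congr1 (m e) zE; rewrite bilMnr idem_mulK.
by rewrite -[RHS]addr0 mulr2n => /addrI ez0; rewrite -zE ez0 mul0rn.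
Qed.

Lemma br_idem x y : b (m e x) y = b (m e x) (m e y).
Proof. by apply/eqP; rewrite -subr_eq0 -bilNr -bilDr br_idem_compl. Qed.

Lemma idem_br x y : m e (b x y) = b (m e x) (m e y).
Proof.
apply: mulr2_inj; rewrite (tp_compat T) br_idem (bN x) (br_idem y) -bN.
by rewrite mulr2n.
Qed.

Lemma compl_mul_bilinear :
  bilinear_for *:%R *:%R (fun x y => m x y - m e (m x y)).
Proof.
by apply: bilinear_forI => k x y z; rewrite !(bilDl, bilZl, bilDr, bilZr); by_scalars.
Qed.
(** The structure of [(1 - e)A] is extended by zero to all of [A] instead of being restricted to a
    subspace, so that the dimension stays the same when the splitting is repeated. *)
Definition compl_mul := mk_bilinear compl_mul_bilinear.

Lemma compl_br_bilinear :
  bilinear_for *:%R *:%R (fun x y => b x y - m e (b x y)).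
Proof.
by apply: bilinear_forI => k x y z; rewrite !(bilDl, bilZl, bilDr, bilZr); by_scalars.
Qed.
Definition compl_br := mk_bilinear compl_br_bilinear.

Lemma compl_mulE x y : compl_mul x y = m x y - m e (m x y).
Proof. exact: mk_bilinearE. Qed.

Lemma compl_brE x y : compl_br x y = b x y - m e (b x y).
Proof. exact: mk_bilinearE. Qed.

Lemma compl_mul_idem x y : compl_mul x (m e y) = 0.
Proof. by rewrite compl_mulE -!idem_comm idem_mulK subrr. Qed.

Lemma compl_br_idem x y : compl_br x (m e y) = 0.
Proof. by rewrite compl_brE idem_br idem_mulK bN br_idem -bN subrr. Qed.

Lemma compl_mulC : commutative compl_mul.
Proof. by move=> x y; rewrite !compl_mulE mC. Qed.

Lemma compl_br_anti x y : compl_br x y = - compl_br y x.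
Proof. by rewrite !compl_brE bN bilNr opprD. Qed.

Lemma compl_mul_compl x y : compl_mul x (y - m e y) = compl_mul x y.
Proof. by rewrite bilDr bilNr compl_mul_idem subr0. Qed.

Lemma compl_br_compl x y : compl_br x (y - m e y) = compl_br x y.
Proof. by rewrite bilDr bilNr compl_br_idem subr0. Qed.

Lemma compl_br_compll x y : compl_br (x - m e x) y = compl_br x y.
Proof. by rewrite compl_br_anti compl_br_compl -compl_br_anti. Qed.

Lemma compl_mul_compll x y : compl_mul (x - m e x) y = compl_mul x y.
Proof. by rewrite compl_mulC compl_mul_compl compl_mulC. Qed.

Lemma compl_mulA : associative compl_mul.
Proof.
move=> x y z; rewrite [compl_mul y z]compl_mulE compl_mul_compl.
rewrite [RHS]compl_mulC [compl_mul x y]compl_mulE compl_mul_compl.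
by rewrite !compl_mulE mA (mC z).
Qed.

Lemma compl_lie : lie_bracket compl_br.
Proof.
split=> [x|x y z]; first by rewrite compl_brE (tp_lie T).1 bil0r subrr.
rewrite [compl_br y z]compl_brE [compl_br z x]compl_brE [compl_br x y]compl_brE.
rewrite !compl_br_compl !compl_brE.
transitivity (b x (b y z) + b y (b z x) + b z (b x y)
  - m e (b x (b y z) + b y (b z x) + b z (b x y))); last first.
  by rewrite (tp_lie T).2 bil0r subr0.
by rewrite !bilDr; by_scalars.
Qed.

Lemma compl_leibniz : transposed_leibniz compl_mul compl_br.
Proof.
move=> x y z; rewrite [compl_br x y]compl_brE compl_mul_compl.
rewrite [compl_mul z x]compl_mulE [compl_mul z y]compl_mulE compl_br_compl.
rewrite compl_br_compll compl_mulE !compl_brE mulrnBl -(bilMnr m e) (tp_compat T).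
by rewrite bilDr; by_scalars.
Qed.

Definition compl_tp : transposedPoisson A :=
  TransposedPoisson compl_mulC compl_mulA compl_lie compl_leibniz.

Lemma compl_linear : linear (fun x : A => x - m e x).
Proof. by move=> k x y; rewrite bilDr bilZr; by_scalars. Qed.

Lemma compl_gd_hom (P : lmodType F) (D : diffPoisson P) (f : {linear A -> P}) :
  gd_hom compl_tp D f -> gd_hom T D (f \o mk_linear compl_linear).
Proof.
move=> [fM fB]; split=> x y /=.
  by rewrite -fM /= compl_mul_compl compl_mul_compll compl_mulE.
by rewrite -fB /= compl_br_compl compl_br_compll compl_brE.
Qed.

Definition euler (x : A) : A := b e (m e x).

Lemma eulerN x : euler (- x) = - euler x.
Proof. by rewrite /euler !bilNr. Qed.

Lemma idem_euler x : m e (euler x) = euler x.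
Proof. by rewrite /euler idem_br ee idem_mulK. Qed.

Lemma euler_mull x y : m (m e x) (euler y) *+ 2 = b (m e x) (m e y) + euler (m x y).
Proof.
rewrite /euler (tp_compat T); congr (b _ _ + b _ _).
  by rewrite mC idem_mulK.
by rewrite idem_mul2.
Qed.

Lemma mul_idem_euler x y : m (m e x) (euler y) = m x (euler y).
Proof. by rewrite (mC e) -mA idem_euler. Qed.

(** Adding [euler_mull] to its instance with [x] and [y] exchanged cancels the bracket and leaves
    twice the derivation rule. *)
Lemma euler_mul x y : euler (m x y) = m (euler x) y + m x (euler y).
Proof.
apply: mulr2_inj; rewrite mulrnDl.
have := euler_mull x y; have := euler_mull y x.
rewrite !mul_idem_euler (mC (euler x)) (mC y x) (bN (m e y)) => -> ->.
by by_scalars.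
Qed.

Lemma br_euler x y : b (m e x) (m e y) = m x (euler y) - m (euler x) y.
Proof.
have := euler_mull x y; rewrite mul_idem_euler euler_mul mulr2n => h.
by apply/eqP; rewrite eq_sym subr_eq -(inj_eq (addIr (m x (euler y)))) h addrA.
Qed.

Lemma unit_C_bilinear : bilinear_for *:%R *:%R (fun x y => - m (euler x) y).
Proof.
by apply: bilinear_forI => k x y z; rewrite /euler !(bilDl, bilZl, bilDr, bilZr); by_scalars.
Qed.
(** With [D = euler], the sign makes [C x y - C y x] equal to [x (D y) - (D x) y], the bracket of
    [br_euler]. *)
Definition unit_C := mk_bilinear unit_C_bilinear.

Lemma unit_CE x y : unit_C x y = - m (euler x) y.
Proof. exact: mk_bilinearE. Qed.

Lemma unit_C_mulr x y z : unit_C x (m y z) = m (unit_C x y) z.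
Proof. by rewrite !unit_CE bilNl mA. Qed.

Lemma unit_C_mull x y z : unit_C (m x y) z = m (unit_C x z) y + m x (unit_C y z).
Proof.
rewrite !unit_CE euler_mul !(bilNl, bilNr, bilDl) opprD -!mA.
by rewrite (mC y z).
Qed.

Lemma unit_C_comm x y z : unit_C x (unit_C y z) = unit_C y (unit_C x z).
Proof. by rewrite !unit_CE !bilNr !opprK !mA (mC (euler x)). Qed.

Lemma unit_C_lie x y z :
  unit_C x (unit_C y z - unit_C z y) = unit_C (unit_C x y) z - unit_C (unit_C x z) y.
Proof.
rewrite !unit_CE !eulerN !euler_mul !(bilNl, bilNr, bilDl, bilDr) -!mA (mC y z).
by by_scalars.
Qed.

Lemma unit_linear : linear (m e).
Proof. by move=> k x y; rewrite bilDr bilZr. Qed.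

Lemma unit_mul x y : m e (m x y) = m (m e x) (m e y).
Proof. by rewrite idem_mul2. Qed.

Lemma unit_br x y :
  m e (b x y) = unit_C (m e x) (m e y) - unit_C (m e y) (m e x).
Proof.
have eulerK z : euler (m e z) = euler z by rewrite /euler idem_mulK.
have mulK u v : m (euler u) (m e v) = m (euler u) v.
  by rewrite mA (mC _ e) idem_euler.
rewrite !unit_CE !eulerK !mulK idem_br br_euler (mC (euler y)); by_scalars.
Qed.

(** The given embedding is precomposed with [x |-> x - e x] and paired with [x |-> t (e x)]. If both
    images of [x] vanish, then so do [e x] and [x - e x]. *)
Lemma idempotent_split :
  special (gd_of_transposedPoisson compl_tp) -> special (gd_of_transposedPoisson T).
Proof.
move=> [P [D [f [f_inj fM fB]]]].
have f_hom : gd_hom compl_tp D f by split.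
have g_hom := @tmodel_hom _ _ T _ _ _ (mk_linear unit_linear) mC mA unit_C_mulr
  unit_C_mull unit_C_comm unit_C_lie unit_mul unit_br.
apply: special_of_hom2 (compl_gd_hom f_hom) g_hom _ => x /= fx0 /tmodel_inj /= ex0.
by apply: f_inj; rewrite linear0 -fx0 ex0 subr0.
Qed.

End Idempotent.

(** * Nil algebras of dimension 3 *)

Section LinearRelations.
Variables (F : fieldType) (A : vectType F).
Implicit Types (x y z : A).

Lemma free3P x y z :
  (forall r s t, r *: x + s *: y + t *: z = 0 -> [/\ r = 0, s = 0 & t = 0]) ->
  free [:: x; y; z].
Proof.
move=> h; suff : free [tuple x; y; z] by []; apply/freeP => k.
rewrite !big_ord_recl big_ord0 addr0 addrA /= => /h [k0 k1 k2] i.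
case: (unliftP ord0 i) => [j ->|-> //].
case: (unliftP ord0 j) => [l ->|-> //].
by case: (unliftP ord0 l) => [[]|->].
Qed.

Lemma relation4 (w x y z : A) : (\dim {:A} <= 3)%N ->
  exists c0 c1 c2 c3 : F, c0 *: w + c1 *: x + c2 *: y + c3 *: z = 0 /\
    ~ [/\ c0 = 0, c1 = 0, c2 = 0 & c3 = 0].
Proof.
move=> hdim; apply: contrapT => h.
have /eqP fr : free [:: w; x; y; z].
  suff : free [tuple w; x; y; z] by []; apply/freeP => k.
  rewrite !big_ord_recl big_ord0 addr0 !addrA /= => k_rel i.
  apply: contrapT => ki; apply: h.
  exists (k ord0), (k (lift ord0 ord0)), (k (lift ord0 (lift ord0 ord0))).
  exists (k (lift ord0 (lift ord0 (lift ord0 ord0)))).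
  split=> // -[k0 k1 k2 k3]; apply: ki.
  case: (unliftP ord0 i) => [j ->|-> //].
  case: (unliftP ord0 j) => [l ->|-> //].
  case: (unliftP ord0 l) => [o ->|-> //].
  by case: (unliftP ord0 o) => [[]|->].
have := leq_trans (dimvS (subvf <<[:: w; x; y; z]>>)) hdim.
by rewrite fr.
Qed.

Lemma coords3 x y z : \dim {:A} = 3%N -> free [:: x; y; z] ->
  exists k : {linear A -> (F^o * F^o * F^o)%type},
    (forall w, w = (k w).1.1 *: x + (k w).1.2 *: y + (k w).2 *: z) /\
    (forall r s t : F, k (r *: x + s *: y + t *: z) = (r, s, t)).
Proof.
move=> hdim fr; pose X := [tuple x; y; z].
have bX : basis_of fullv X.
  by rewrite basisEfree fr subvf hdim.
have lin : linear (fun w => (coord X ord0 w, coord X (lift ord0 ord0) w,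
    coord X (lift ord0 (lift ord0 ord0)) w) : (F^o * F^o * F^o)%type).
  by move=> c u v; rewrite !linearP.
exists (mk_linear lin); split=> [w|r s t].
  rewrite {1}(coord_basis bX (memvf w)) !big_ord_recl big_ord0 addr0 addrA /=.
  by [].
have -> : r *: x + s *: y + t *: z = \sum_(i < 3) [:: r; s; t]`_i *: X`_i.
  by rewrite !big_ord_recl big_ord0 addr0 addrA.
by rewrite /= !(coord_sum_free _ _ fr).
Qed.

End LinearRelations.

(** * Algebras spanned by [a], [a ^ 2], [a ^ 3] with [a ^ 4 = 0] *)

Section Curvilinear.
Variables (F : numFieldType) (A : vectType F) (T : transposedPoisson A) (a : A).
Local Notation m := (tp_mul T).
Local Notation b := (tp_br T).
Local Notation u := (m a a).
Local Notation v := (m a (m a a)).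
Hypothesis hdim : \dim {:A} = 3%N.
Hypothesis v_neq0 : v != 0.
Hypothesis av0 : m a v = 0.

Lemma curvilinear_free : free [:: a; u; v].
Proof.
have cancel_v r : r *: v = 0 -> r = 0.
  by move/eqP; rewrite scaler_eq0 (negPf v_neq0) orbF => /eqP.
apply: free3P => r s t rel.
have r0 : r = 0.
  have := congr1 (fun w => m a (m a w)) rel.
  by rewrite /= !(bilDr, bilZr, bil0r) av0 bil0r !scaler0 !addr0 => /cancel_v.
have s0 : s = 0.
  have := congr1 (m a) rel.
  by rewrite r0 scale0r add0r !(bilDr, bilZr, bil0r) av0 scaler0 addr0 => /cancel_v.
by split=> //; move: rel; rewrite r0 s0 !scale0r !add0r => /cancel_v.
Qed.

(** The transposed Leibniz rule gives [2 a ^ 2 [a, u] = - [u, v]] and [4 a ^ 2 [a, u] = 2 a [a, v] =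
    [u, v]]. Hence [6 a ^ 2 [a, u] = 0], so [[u, v] = 0] and [[a, u]] has no component along [a]. *)
Lemma curvilinear_br : exists al be : F,
  [/\ b a u = al *: u + be *: v, b a v = (2%:R * al) *: v & b u v = 0].
Proof.
have [k [kE _]] := coords3 hdim curvilinear_free.
have bN := lie_antisym (tp_lie T).
have e1 : m a (b a u) *+ 2 = b a v.
  by rewrite (tp_compat T) (tp_lie T).1 add0r.
have e2 : m a (b a v) *+ 2 = b u v by rewrite (tp_compat T) av0 bil0r addr0.
have e3 : m a (m a (b a u)) *+ 2 = - b u v.
  by rewrite (tp_mulA T) (tp_compat T) -!(tp_mulA T) av0 bil0r addr0 -bN.
have e4 : m a (m a (b a u)) = 0.
  have e5 : m a (m a (b a u)) *+ 6 = 0.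
    rewrite (mulrnDr _ 2 4) e3 (mulrnA _ 2 2) -(bilMnr m) e1 e2 addNr //.
  move/eqP: e5; rewrite -scaler_nat scaler_eq0 pnatr_eq0 /=.
  by move/eqP.
have uv0 : b u v = 0 by apply/eqP; rewrite -oppr_eq0 -e3 e4 mul0rn.
set r := (k (b a u)).1.1; set al := (k (b a u)).1.2; set be := (k (b a u)).2.
have bE : b a u = r *: a + al *: u + be *: v by exact: kE.
have r0 : r = 0.
  move: e4; rewrite bE !(bilDr, bilZr) av0 bil0r !scaler0 !addr0 => /eqP.
  by rewrite scaler_eq0 (negPf v_neq0) orbF => /eqP.
exists al, be; split=> //; first by rewrite bE r0 scale0r add0r.
rewrite -e1 bE r0 scale0r add0r !(bilDr, bilZr) av0 scaler0 addr0.
by by_scalars.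
Qed.

Local Notation B := (F^o * F^o * F^o)%type.

Definition curv_mul_fun (x y : B) : B :=
  (0, x.1.1 * y.1.1, x.1.1 * y.1.2 + x.1.2 * y.1.1).

(* With [x], [x ^ 2], [x ^ 3] as coordinates this is [- (al + be x) (d f / dx) g]. *)
Definition curv_C_fun (al be : F) (x y : B) : B :=
  (- (x.1.1 * (al * y.1.1)),
   - (x.1.1 * (al * y.1.2 + be * y.1.1) + 2%:R * x.1.2 * (al * y.1.1)),
   - (x.1.1 * (al * y.2 + be * y.1.2)
      + 2%:R * x.1.2 * (al * y.1.2 + be * y.1.1) + 3%:R * al * x.2 * y.1.1)).

Lemma addB (x1 x2 x3 y1 y2 y3 : F) :
  ((x1, x2, x3) : B) + (y1, y2, y3) = (x1 + y1, x2 + y2, x3 + y3).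
Proof. by []. Qed.
Lemma oppB (x1 x2 x3 : F) : - ((x1, x2, x3) : B) = (- x1, - x2, - x3).
Proof. by []. Qed.

Lemma curv_mul_bilinear : bilinear_for *:%R *:%R curv_mul_fun.
Proof.
apply: bilinear_forI => k [[x1 x2] x3] [[y1 y2] y3] [[z1 z2] z3];
  by rewrite /curv_mul_fun; congr (_, _, _); rewrite /= /GRing.scale /=; ring.
Qed.
Definition curv_mul := mk_bilinear curv_mul_bilinear.

Lemma curv_C_bilinear al be : bilinear_for *:%R *:%R (curv_C_fun al be).
Proof.
apply: bilinear_forI => k [[x1 x2] x3] [[y1 y2] y3] [[z1 z2] z3];
  by rewrite /curv_C_fun; congr (_, _, _); rewrite /= /GRing.scale /=; ring.
Qed.
Definition curv_C al be := mk_bilinear (curv_C_bilinear al be).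

Lemma curv_mulE x1 x2 x3 y1 y2 y3 : curv_mul (x1, x2, x3) (y1, y2, y3) =
  (0, x1 * y1, x1 * y2 + x2 * y1).
Proof. exact: mk_bilinearE. Qed.

Lemma curv_CE al be x1 x2 x3 y1 y2 y3 : curv_C al be (x1, x2, x3) (y1, y2, y3) =
  (- (x1 * (al * y1)),
   - (x1 * (al * y2 + be * y1) + 2%:R * x2 * (al * y1)),
   - (x1 * (al * y3 + be * y2)
      + 2%:R * x2 * (al * y2 + be * y1) + 3%:R * al * x3 * y1)).
Proof. exact: mk_bilinearE. Qed.

Lemma curv_mulC : commutative curv_mul.
Proof.
by move=> [[x1 x2] x3] [[y1 y2] y3]; rewrite !curv_mulE; congr (_, _, _); ring.
Qed.

Lemma curv_mulA : associative curv_mul.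
Proof.
move=> [[x1 x2] x3] [[y1 y2] y3] [[z1 z2] z3]; rewrite !curv_mulE.
by congr (_, _, _); ring.
Qed.

Lemma curv_C_mulr al be x y z :
  curv_C al be x (curv_mul y z) = curv_mul (curv_C al be x y) z.
Proof.
move: x y z => [[x1 x2] x3] [[y1 y2] y3] [[z1 z2] z3].
by rewrite !(curv_mulE, curv_CE); congr (_, _, _); ring.
Qed.

(** Truncation at [x ^ 4] respects the derivation: for [f] divisible by [x ^ 4] and [g] without
    constant term, [(d f / dx) g] is still divisible by [x ^ 4]. *)
Lemma curv_C_mull al be x y z : curv_C al be (curv_mul x y) z =
  curv_mul (curv_C al be x z) y + curv_mul x (curv_C al be y z).
Proof.
move: x y z => [[x1 x2] x3] [[y1 y2] y3] [[z1 z2] z3].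
by rewrite !(curv_mulE, curv_CE) !addB; congr (_, _, _); ring.
Qed.

Lemma curv_C_comm al be x y z :
  curv_C al be x (curv_C al be y z) = curv_C al be y (curv_C al be x z).
Proof.
move: x y z => [[x1 x2] x3] [[y1 y2] y3] [[z1 z2] z3].
by rewrite !curv_CE; congr (_, _, _); ring.
Qed.

Lemma curv_C_lie al be x y z :
  curv_C al be x (curv_C al be y z - curv_C al be z y) =
  curv_C al be (curv_C al be x y) z - curv_C al be (curv_C al be x z) y.
Proof.
move: x y z => [[x1 x2] x3] [[y1 y2] y3] [[z1 z2] z3].
rewrite (curv_CE _ _ y1) (curv_CE _ _ z1) oppB addB.
rewrite (curv_CE _ _ x1 x2 x3 y1) (curv_CE _ _ x1 x2 x3 z1) !curv_CE oppB addB.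
by congr (_, _, _); ring.
Qed.

Lemma curvilinear_special : special (gd_of_transposedPoisson T).
Proof.
have [k [kE kX]] := coords3 hdim curvilinear_free.
have [al [be [au avE uv]]] := curvilinear_br.
have bN := lie_antisym (tp_lie T).
have ua : b u a = - (al *: u + be *: v) by rewrite bN au.
have va : b v a = - ((2%:R * al) *: v) by rewrite bN avE.
have vu : b v u = 0 by rewrite bN uv oppr0.
have bxx := (tp_lie T).1.
have uaE : m u a = v by rewrite (tp_mulC T).
have uuE : m u u = 0 by rewrite -(tp_mulA T).
have vaE : m v a = 0 by rewrite (tp_mulC T).
have uvE : m u v = 0 by rewrite -(tp_mulA T) av0 bil0r.
have vuE : m v u = 0 by rewrite (tp_mulC T).
have vvE : m v v = 0 by rewrite -(tp_mulA T) uvE bil0r.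
have kM x y : k (m x y) = curv_mul (k x) (k y).
  rewrite {1}(kE x) {1}(kE y); case: (k x) => [[x1 x2] x3]; case: (k y) => [[y1 y2] y3].
  cbn [fst snd]; rewrite curv_mulE -kX; congr (k _).
  rewrite !(bilDl, bilDr, bilZl, bilZr) uaE uuE vaE uvE vuE vvE av0.
  by by_scalars.
have kB x y : k (b x y) = curv_C al be (k x) (k y) - curv_C al be (k y) (k x).
  rewrite {1}(kE x) {1}(kE y); case: (k x) => [[x1 x2] x3]; case: (k y) => [[y1 y2] y3].
  cbn [fst snd]; rewrite !curv_CE oppB addB -kX; congr (k _).
  rewrite !(bilDl, bilDr, bilZl, bilZr) ua au va avE uv vu !bxx.
  by by_scalars.
apply: (special_of_hom (tmodel_hom curv_mulC curv_mulA (@curv_C_mulr al be)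
  (@curv_C_mull al be) (@curv_C_comm al be) (@curv_C_lie al be) kM kB)) => x /= /tmodel_inj kx0.
by rewrite (kE x) kx0 /= !scale0r !addr0.
Qed.

End Curvilinear.

(** * Idempotents and nilpotency *)

Section NilOrIdempotent.
Variables (F : numFieldType) (A : vectType F) (T : transposedPoisson A).
Local Notation m := (tp_mul T).
Local Notation b := (tp_br T).
Let mC : commutative m := tp_mulC T.
Let mA : associative m := tp_mulA T.

(** In a linear relation between [a], ..., [a ^ 4], let [a ^ i] be the lowest power with nonzero
    coefficient. If [i < 4], dividing by that coefficient gives [a ^ i = a ^ i f] with [f] a
    polynomial in [a] without constant term, and [f ^ i] is idempotent. If [i = 4], then
    [a ^ 4 = 0]. *)
Lemma idempotent_or_nil4 (a : A) : (\dim {:A} <= 3)%N ->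
  (exists2 e, e != 0 & m e e = e) \/ m a (m a (m a a)) = 0.
Proof.
move=> hdim; pose u := m a a; pose v := m a u; pose w := m a v.
have idem e x : x != 0 -> m x e = x -> m e e = e -> exists2 e, e != 0 & m e e = e.
  move=> x0 xe e2; exists e => //; apply: contra_neq x0 => e0.
  by rewrite -xe e0 bil0r.
have [w0|w_neq0] := eqVneq w 0; [by right|left].
have a_neq0 : a != 0 by apply: contra_neq w_neq0; rewrite /w => ->; rewrite bil0l.
have u_neq0 : u != 0.
  by apply: contra_neq w_neq0; rewrite /w /v => ->; rewrite !bil0r.
have v_neq0 : v != 0 by apply: contra_neq w_neq0; rewrite /w => ->; rewrite !bil0r.
have uu : m u u = w by rewrite /w /v mA -/u /u !mA.
have ua : m u a = v by rewrite mC.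
have va : m v a = w by rewrite mC.
have [c1 [c2 [c3 [c4 [rel nz]]]]] := relation4 a u v w hdim.
have solve (c : F) (x y : A) : c != 0 -> c *: x + y = 0 -> x = - (c^-1 *: y).
  move=> c0 /eqP; rewrite addr_eq0 => /eqP e.
  by rewrite -scalerN -e scalerA mulVf // scale1r.
have [c1_0|c1_0] := eqVneq c1 0; last first.
  pose e := - (c1^-1 *: (c2 *: a + c3 *: u + c4 *: v)).
  have ae : m a e = a.
    rewrite [RHS](solve c1 _ (c2 *: u + c3 *: v + c4 *: w) c1_0).
      by rewrite !(bilNr, bilZr, bilDr).
    by rewrite -rel !addrA.
  have ue : m u e = u by rewrite /u -mA ae.
  have ve : m v e = v by rewrite /v -mA ue.
  apply: (idem e a) => //; rewrite {1}/e !(bilNl, bilZl, bilDl) ae ue ve //.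
have [c2_0|c2_0] := eqVneq c2 0; last first.
  pose f := - (c2^-1 *: (c3 *: a + c4 *: u)).
  have uf : m u f = u.
    rewrite [RHS](solve c2 _ (c3 *: v + c4 *: w) c2_0).
      by rewrite !(bilNr, bilZr, bilDr) ua uu.
    by rewrite -rel c1_0 scale0r add0r !addrA.
  have vf : m v f = v by rewrite /v -mA uf.
  have wf : m w f = w by rewrite /w -mA vf.
  (* The square is needed because [f] is only known to fix the powers of [a] from the second on;
     [f ^ 2] is a combination of those, [f] need not be. *)
  pose e := m f f.
  have eE : m e f = e.
    have fE : f = - (c2^-1 * c3) *: a + - (c2^-1 * c4) *: u.
      by rewrite /f; by_scalars.
    set k := - _ in fE; set l := - _ in fE.
    have -> : e = (k * k) *: u + (k * l *+ 2) *: v + (l * l) *: w.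
      rewrite /e fE !(bilDl, bilDr, bilZl, bilZr) -/u ua uu -/v; by_scalars.
    by rewrite !(bilDl, bilZl) uf vf wf.
  apply: (idem e u) => //; first by rewrite /e mA !uf.
  by rewrite {2}/e mA !eE.
have [c3_0|c3_0] := eqVneq c3 0; last first.
  pose f := - (c3^-1 *: (c4 *: a)).
  have vf : m v f = v.
    rewrite [RHS](solve c3 _ (c4 *: w) c3_0); last first.
      by rewrite -rel c1_0 c2_0 !scale0r !add0r.
    by rewrite !(bilNr, bilZr, bilDr) va.
  pose g := m f f; pose e := m g f.
  have eE : m e f = e.
    have [k fE] : exists k, f = k *: a by exists (- (c3^-1 * c4)); rewrite /f scaleNr scalerA.
    have eV : e = (k * k * k) *: v.
      by rewrite /e /g fE !(bilZl, bilZr) -/u ua !scalerA.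
    by rewrite eV bilZl vf.
  apply: (idem e v) => //; first by rewrite /e /g mA mA !vf.
  by rewrite {2}/e mA {1}/g mA !eE.
case: nz; split=> //; move/eqP: rel.
by rewrite c1_0 c2_0 c3_0 !scale0r !add0r scaler_eq0 (negPf w_neq0) orbF => /eqP.
Qed.

Lemma cube_add x y : m (x + y) (m (x + y) (x + y)) =
  (m (m x x) y + m (m y y) x) *+ 3 + (m x (m x x) + m y (m y y)).
Proof.
have e1 : m x (m y x) = m (m x x) y by rewrite (mC y) mA.
have e2 : m y (m x y) = m (m y y) x by rewrite (mC x) mA.
rewrite !(bilDl, bilDr) e1 e2 (mA x x y) (mA y y x) (mC y (m x x)) (mC x (m y y)).
by_scalars.
Qed.

(** The cubes of [x + y] and [x - y] give [x ^ 2 y + y ^ 2 x = 0] and [y ^ 2 x - x ^ 2 y = 0], hence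
    [x ^ 2 y = 0]. Polarizing the square finishes. *)
Lemma nil3_mul3 : (forall a, m a (m a a) = 0) -> forall x y z, m x (m y z) = 0.
Proof.
move=> nil3.
have two (x : A) : x + x = 0 -> x = 0.
  by move=> xx; apply: mulr2_inj; rewrite mul0rn mulr2n.
have sq x y : m (m x x) y = 0.
  have three (z : A) : z *+ 3 = 0 -> z = 0.
    by move/eqP; rewrite -scaler_nat scaler_eq0 pnatr_eq0 /= => /eqP.
  have := cube_add x y; rewrite !nil3 !addr0 => /esym /three e1.
  have := cube_add x (- y); rewrite !nil3 !addr0 => /esym /three.
  rewrite !(bilNr, bilNl) opprK => e2; apply: two.
  by rewrite -[RHS](subrr 0) -{1}e1 -e2; by_scalars.
move=> x y z; rewrite mC; apply: two.
have := sq (y + z) x; rewrite !(bilDl, bilDr) !sq addr0 add0r (mC z y).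
by [].
Qed.

End NilOrIdempotent.

(** * The abelian Lie ideal in dimension 3 when [A ^ 3 = 0] *)

Section Classification.
Variables (F : numFieldType) (A : vectType F) (T : transposedPoisson A).
Local Notation m := (tp_mul T).
Local Notation b := (tp_br T).
Let mC : commutative m := tp_mulC T.
Let bN := lie_antisym (tp_lie T).

Lemma three_step_vspace (Z : {vspace A}) :
  (forall x y, m x y \in Z) -> (forall x z, z \in Z -> m x z = 0) ->
  (forall x z, z \in Z -> b x z \in Z) ->
  (forall y z, y \in Z -> z \in Z -> b y z = 0) ->
  special (gd_of_transposedPoisson T).
Proof.
move=> mZ mZ0 bZ bZ0; apply: (@three_step_special _ _ T (projv Z)) => *.
- exact: projv_proj.
- exact/projv_id/mZ.
- exact/mZ0/memv_proj.
- exact/projv_id/bZ/memv_proj.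
- by apply: bZ0; apply: memv_proj.
Qed.

(** The ideal for [three_step_vspace] is zero, the line of a nonzero square [z], or the plane
    spanned by [z] and a bracket [[x, z]]. *)
Lemma mul3_zero_special : \dim {:A} = 3%N -> (forall x y z, m x (m y z) = 0) ->
  special (gd_of_transposedPoisson T).
Proof.
move=> hdim mul3.
have [m0|/existsNP [a /eqP z_neq0]] := pselect (forall a, m a a = 0).
  have mm0 x y : m x y = 0.
    have := m0 (x + y); rewrite !(bilDl, bilDr) !m0 addr0 add0r (mC y x) => xx.
    by apply: mulr2_inj; rewrite mul0rn mulr2n.
  apply: (@three_step_vspace 0%VS) => [x y|x z|x z|y z]; rewrite ?mm0 ?mem0v //.
    by rewrite memv0 => /eqP ->; rewrite bil0r mem0v.
  by rewrite memv0 => /eqP -> _; rewrite bil0l.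
pose z := m a a.
have cancel_z r : r *: z = 0 -> r = 0.
  by move/eqP; rewrite scaler_eq0 (negPf z_neq0) orbF => /eqP.
have xz0 x : m x z = 0 by exact: mul3.
have zx0 x : m z x = 0 by rewrite mC.
(* An annihilating [y] outside [<[z]>] completes [a, z] to a basis. *)
have basis y : (forall x, m x y = 0) -> y \notin <[z]>%VS -> free [:: a; z; y].
  move=> xy0 y_notin; apply: free3P => r s t rel.
  have r0 : r = 0.
    have := congr1 (m a) rel; rewrite !(bilDr, bilZr, bil0r) xz0 xy0 !scaler0 !addr0.
    exact: cancel_z.
  have t0 : t = 0.
    apply: contraNeq y_notin => t0; apply/vlineP.
    exists (- (t^-1 * s)); move: rel; rewrite r0 scale0r add0r => /eqP.
    rewrite addrC addr_eq0 => /eqP ty.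
    by rewrite scaleNr -scalerA -scalerN -ty scalerA mulVf // scale1r.
  by split=> //; move: rel; rewrite r0 t0 !scale0r add0r addr0 => /cancel_z.
have mulE w (w_notin : w \notin <[z]>%VS) (xw0 : forall x, m x w = 0)
    (k : {linear A -> (F^o * F^o * F^o)%type})
    (kE : forall x, x = (k x).1.1 *: a + (k x).1.2 *: z + (k x).2 *: w) x y :
    m x y = ((k x).1.1 * (k y).1.1) *: z.
  rewrite {1}(kE x) {1}(kE y) !(bilDl, bilDr, bilZl, bilZr) (mC w) (mC z) !xz0 !xw0.
  by rewrite !(scaler0, addr0) scalerA.
(* If [m x y] were outside the line, it would complete [a], [z] to a basis, and [mulE] would put
   every product, this one included, back into the line. *)
have mZ x y : m x y \in <[z]>%VS.
  have [//|w_notin] := boolP (m x y \in <[z]>%VS).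
  have xw0 u : m u (m x y) = 0 by exact: mul3.
  have [k [kE _]] := coords3 hdim (basis _ xw0 w_notin).
  by rewrite -(negPf w_notin); have -> := mulE _ w_notin xw0 k kE x y; rewrite memvZ ?memv_line.
have [lie_ideal|/existsNP [x /negP y_notin]] := pselect (forall x, b x z \in <[z]>%VS).
  apply: (@three_step_vspace <[z]>%VS) => // [x w|x w|y w] /vlineP [r ->].
  - by rewrite bilZr xz0 scaler0.
  - by rewrite bilZr memvZ.
  by move/vlineP=> [s ->]; rewrite bilZl bilZr (tp_lie T).1 !scaler0.
(* Here [2 u [v, z] = [u v, z] + [v, u z]], where [u v] is a multiple of [z] and [u z = 0]. *)
have ann_br u v : m u (b v z) = 0.
  apply: mulr2_inj; rewrite mul0rn (tp_compat T) xz0 bil0r addr0.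
  have /vlineP [r ->] := mZ u v.
  by rewrite bilZl (tp_lie T).1 scaler0.
set y := b x z in y_notin; have xy0 u : m u y = 0 by exact: ann_br.
have [k [kE kX]] := coords3 hdim (basis _ xy0 y_notin).
have ann_k w : (forall u, m u w = 0) -> (k w).1.1 = 0.
  move=> /(_ a); rewrite {1}(kE w) !(bilDr, bilZr) xz0 xy0 !scaler0 !addr0.
  exact: cancel_z.
set al := (k (b a y)).1.1.
(* Since [a y = 0], the transposed Leibniz rule reads [2 a [a, y] = [z, y]]. *)
have zy : b z y = (al *+ 2) *: z.
  have := tp_compat T a y a; rewrite xy0 bil0r addr0 -/z => <-.
  by rewrite [b a y]kE !(bilDr, bilZr) xz0 xy0 !scaler0 !addr0 scalerMnl.
have yz : b y z = - (al *+ 2) *: z by rewrite bN zy scaleNr.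
set q := k (b a z); have azE : b a z = q.1.2 *: z + q.2 *: y.
  by rewrite [LHS]kE -/q (ann_k (b a z)) // scale0r add0r.
have ky : k y = (0, 0, 1) by rewrite -kX scale1r !scale0r !add0r.
have k_zy r s : k (r *: z + s *: y) = (0, r, s).
  by rewrite -[RHS]kX scale0r add0r.
(* Comparing coefficients of [y] in [y = [x, z]]: only the component of [x] along [a] contributes,
   with the factor [q.2]. *)
have q_neq0 : q.2 != 0.
  have yE : y = ((k x).1.1 * q.1.2 - (k x).2 * (al *+ 2)) *: z + ((k x).1.1 * q.2) *: y.
    rewrite {1}/y {1}(kE x) !(bilDl, bilZl) (tp_lie T).1 azE yz; by_scalars.
  have := congr1 k yE; rewrite ky k_zy => -[_ e]; apply/eqP => q0.
  by move/eqP: e; rewrite q0 mulr0 oner_eq0.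
(* The coefficient of [y] in the Jacobi identity for [a], [y], [z] is [- 3 al q.2]. Once [al = 0],
   the plane of [z] and [y] is abelian and [[a, y]] lies in it. *)
have al0 : al = 0.
  have := (tp_lie T).2 a y z; rewrite yz (bN z a) bilZr.
  rewrite [b a y]kE -/al !(bilDr, bilZr, bilNr) azE (bN z a) azE zy (tp_lie T).1.
  rewrite (_ : _ + _ = (- (3%:R * al * q.1.2) + q.1.2 * (al *+ 2) + (k (b a y)).2 * (al *+ 2)) *: z
    + (- (3%:R * al * q.2)) *: y); last by rewrite !(bilDr, bilZr) yz (tp_lie T).1; by_scalars.
  move/(congr1 k); rewrite k_zy linear0 => -[_ /eqP].
  by rewrite oppr_eq0 mulf_eq0 (negPf q_neq0) orbF mulf_eq0 pnatr_eq0 /= => /eqP.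
have zy0 : b z y = 0 by rewrite zy al0 mul0rn scale0r.
have inZ w : (k w).1.1 = 0 -> w \in (<[z]> + <[y]>)%VS.
  move=> w0; rewrite (kE w) w0 scale0r add0r.
  by rewrite memv_add // memvZ ?memv_line.
have ZE w : w \in (<[z]> + <[y]>)%VS -> exists r s, w = r *: z + s *: y.
  by case/memv_addP => _ /vlineP [r ->] [_ /vlineP [s ->] ->]; exists r, s.
apply: (@three_step_vspace (<[z]> + <[y]>)%VS).
- by move=> u v; apply/inZ/ann_k => w; apply: mul3.
- by move=> u _ /ZE [r [s ->]]; rewrite !(bilDr, bilZr) xz0 xy0 !scaler0 addr0.
- move=> u _ /ZE [r [s ->]]; rewrite !(bilDr, bilZr) memvD ?memvZ //.
    exact/inZ/ann_k.
  apply: inZ; rewrite {1}(kE u) !(bilDl, bilZl) zy0 (tp_lie T).1 !scaler0 !addr0.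
  by rewrite linearZ /= -/al al0 scaler0.
- move=> _ _ /ZE [r [s ->]] /ZE [r' [s' ->]]; rewrite !(bilDr, bilZr, bilDl, bilZl).
  by rewrite (bN y z) zy0 oppr0 !(tp_lie T).1 !(scaler0, addr0).
Qed.

End Classification.

(** * Induction on the codimension of the annihilator *)

Section Annihilator.
Variables (F : numFieldType) (A : vectType F).

Definition annihilator (T : transposedPoisson A) : {vspace A} :=
  lker (linfun (mk_linear (lam_linear T))).

Lemma annihilatorP (T : transposedPoisson A) x :
  reflect (forall y, tp_mul T x y = 0) (x \in annihilator T).
Proof.
rewrite memv_ker lfunE; apply: (iffP eqP) => [x0 y|x0].
  by have := congr1 (fun f : 'End(A) => f y) x0; rewrite /= lamE zero_lfunE.
by apply/lfunP => y; rewrite lamE x0 zero_lfunE.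
Qed.

(** Passing to the complement keeps every annihilating element and adds [e], which did not
    annihilate because [e e = e] is nonzero. This makes the splitting terminate. *)
Lemma annihilator_compl (T : transposedPoisson A) e (ee : tp_mul T e e = e) :
  e != 0 -> (\dim (annihilator T) < \dim (annihilator (compl_tp ee)))%N.
Proof.
move=> e_neq0; have sub : (annihilator T <= annihilator (compl_tp ee))%VS.
  apply/subvP => x /annihilatorP x0; apply/annihilatorP => y.
  by rewrite /= compl_mulE x0 bil0r subrr.
rewrite (ltn_leqif (dimv_leqif_sup sub)); apply/negP => /subvP.
have e_ann : e \in annihilator (compl_tp ee).
  by apply/annihilatorP => y; have := compl_mul_idem ee y e; rewrite ee /= compl_mulC.
move/(_ e e_ann)/annihilatorP => /(_ e); rewrite ee => e0.
by rewrite e0 eqxx in e_neq0.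
Qed.

Lemma dim3_special (T : transposedPoisson A) :
  \dim {:A} = 3%N -> special (gd_of_transposedPoisson T).
Proof.
move=> hdim; have [n] := ubnP (\dim {:A} - \dim (annihilator T))%N.
elim: n T => // n IH T le_n.
have [[e e_neq0 ee]|no_idem] := pselect (exists2 e, e != 0 & tp_mul T e e = e).
  apply: (@idempotent_split _ _ _ _ ee); apply: IH.
  have lt := annihilator_compl ee e_neq0.
  have le3 := dimvS (subvf (annihilator (compl_tp ee))).
  exact: leq_trans (ltn_sub2l (leq_trans lt le3) lt) le_n.
have nil4 a : tp_mul T a (tp_mul T a (tp_mul T a a)) = 0.
  by have [] := idempotent_or_nil4 T a (eq_leq hdim).
have [nil3|/existsNP [a /eqP a3]] :=
  pselect (forall a, tp_mul T a (tp_mul T a a) = 0).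
  exact: mul3_zero_special hdim (nil3_mul3 nil3).
exact: curvilinear_special hdim a3 (nil4 a).
Qed.

End Annihilator.

Theorem theorem3p8 (R : realType) (A : vectType R[i])
    (T : transposedPoisson A) (hdim : \dim {:A} = 3%N) :
  special (gd_of_transposedPoisson T).
Proof. exact: dim3_special. Qed.
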